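(* There exist an absolute sequence $(\alpha_n)_{n\ge1}$ with $\alpha_n\to0$ and an absolute constant $C>0$ such that the following holds. Let $\varepsilon>0$, $b\in\mathbb{R}$, $\Sigma\ge0$, let $\nu_\varepsilon$ be a Lévy measure with support in $[-\varepsilon,\varepsilon]$ and let $X(\varepsilon)\sim(b,\Sigma^2,\nu_\varepsilon)$. For any integer $n\ge1$ and any $\Delta>0$ such that $$\varepsilon\le\sqrt{(\Sigma^2+\sigma^2(\varepsilon))\Delta}\,\big(\log(e\vee n)\big)^2\quad\text{and}\quad\lambda_{0,\varepsilon}\ge\Delta^{-1}\vee\frac{\log(e\vee n)}{n\Delta},$$ one has $$\Big\|(X_\Delta(\varepsilon))^{\otimes n}-\mathcal{N}\big(b(\varepsilon)\Delta,\Delta(\Sigma^2+\sigma^2(\varepsilon))\big)^{\otimes n}\Big\|_{TV}\ge1-C\left[\frac{\Delta(\Sigma^2+\sigma^2(\varepsilon))^3}{n\mu_3(\varepsilon)^2}\wedge\frac{\Delta^2(\Sigma^2+\sigma^2(\varepsilon))^4}{n\mu_4(\varepsilon)^2}\right]-\alpha_n.$$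
   Context: A Lévy process $X$ has triplet $(b,\Sigma^2,\nu)$ (written $X\sim(b,\Sigma^2,\nu)$), where $\nu(\{0\})=0$ and $\int(x^2\wedge1)\nu(dx)<\infty$, if $\mathbb{E}[e^{itX_1}]=\exp\big(itb-\tfrac{\Sigma^2t^2}{2}+\int(e^{itx}-1-itx\mathbf{1}_{|x|\le1})\nu(dx)\big)$. For $X(\varepsilon)\sim(b,\Sigma^2,\nu_\varepsilon)$ with $\nu_\varepsilon$ supported in $[-\varepsilon,\varepsilon]$: $b(\varepsilon)=b$ if $\varepsilon\le1$ and $b(\varepsilon)=b+\int_{1<|x|\le\varepsilon}x\,\nu_\varepsilon(dx)$ if $\varepsilon>1$ (so $\mathbb{E}[X_\Delta(\varepsilon)]=\Delta b(\varepsilon)$); $\sigma^2(\varepsilon)=\int_{|x|\le\varepsilon}x^2\nu_\varepsilon(dx)$; $\mu_k(\varepsilon)=\int_{|x|\le\varepsilon}x^k\nu_\varepsilon(dx)$; $\lambda_{0,\varepsilon}=\int_{0<|x|\le\varepsilon}\nu_\varepsilon(dx)\in[0,+\infty]$. $a\vee b$ and $a\wedge b$ denote maximum and minimum. A quotient with zero denominator is read as $+\infty$. For probability measures, $\|P-Q\|_{TV}=\sup_B|P(B)-Q(B)|$; random variables are identified with their laws, and $Y^{\otimes n}$ (or $P^{\otimes n}$) denotes the law of $n$ i.i.d. copies. $\mathcal{N}(m,v)$ is the Gaussian law with mean $m$ and variance $v$. *)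

(* Defs.v *)
From HB Require Import structures.
From mathcomp Require Import all_boot all_order all_algebra.
From mathcomp Require Import all_classical all_reals all_analysis.
From mathcomp Require Import complex.

Set Implicit Arguments.
Unset Strict Implicit.
Unset Printing Implicit Defensive.

Import Order.TTheory GRing.Theory Num.Theory.
Import numFieldNormedType.Exports.

Local Open Scope classical_set_scope.
Local Open Scope ring_scope.
Local Open Scope complex_scope.

Section ComplexIntegral.
Context {R : realType}.

Definition cexp (z : R[i]) : R[i] :=
  (expR (complex.Re z))%:C * (cos (complex.Im z) +i* sin (complex.Im z)).

Definition cintegral d (T : measurableType d) (mu : {measure set T -> \bar R})
    (f : T -> R[i]) : R[i] :=
  (\int[mu]_x complex.Re (f x)) +i* (\int[mu]_x complex.Im (f x)).

Definition char_fun (mu : {measure set R -> \bar R}) (t : R) : R[i] :=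
  cintegral mu (fun x => cexp ((t * x) *i)).

End ComplexIntegral.

Section Levy.
Context {R : realType}.

Definition levy_measure (nu : {measure set R -> \bar R}) : Prop :=
  nu [set 0] = 0%E /\
  (\int[nu]_x (Num.min (x ^+ 2) 1)%:E < +oo)%E.

(* Only the times [0 <= t] are relevant. *)
Record levy_process d (T : measurableType d) (P : probability T R)
    (X : R -> {RV P >-> R}) : Prop := LevyProcess {
  levy_start : {ae P, forall w, X 0 w = 0};
  (* Mutual independence: letting some [B i] be [setT] gives the product rule
     for every subfamily of the increments. *)
  levy_independent : forall (k : nat) (t : nat -> R) (B : nat -> set R),
    0 <= t 0%N -> (forall i, (i < k)%N -> t i <= t i.+1) ->
    (forall i, measurable (B i)) ->
    P (\bigcap_(i < k) [set w | B i (X (t i.+1) w - X (t i) w)]) =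
    (\prod_(i < k) P [set w | B i (X (t i.+1) w - X (t i) w)%R])%E;
  levy_stationary : forall (s t : R) (B : set R),
    0 <= s -> 0 <= t -> measurable B ->
    P [set w | B (X (s + t) w - X s w)] = P [set w | B (X t w)];
  levy_stoch_continuous : forall t e : R, 0 <= t -> 0 < e ->
    P [set w | e <= `|X s w - X t w|]
      @[s --> within [set s | 0 <= s] (nbhs t)] --> 0%E;
  levy_cadlag : {ae P, forall w,
    (forall t : R, 0 <= t -> X s w @[s --> t^'+] --> X t w) /\
    (forall t : R, 0 < t -> cvg (X s w @[s --> t^'-]))}
}.

Definition levy_exponent (b Sigma : R) (nu : {measure set R -> \bar R}) (t : R) :
    R[i] :=
  (t * b) *i - (Sigma ^+ 2 * t ^+ 2 / 2)%:C
  + cintegral nu (fun x : R => cexp ((t * x) *i) - 1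
                           - (t * x * \1_[set y : R | `|y| <= 1] x) *i).

(* [X ~ (b, Sigma^2, nu)] *)
Definition has_triplet d (T : measurableType d) (P : probability T R)
    (X : R -> {RV P >-> R}) (b Sigma : R) (nu : {measure set R -> \bar R}) : Prop :=
  forall t : R, char_fun (distribution P (X 1)) t = cexp (levy_exponent b Sigma nu t).

Definition drift (b : R) (nu : {measure set R -> \bar R}) (eps : R) : R :=
  if eps <= 1 then b
  else b + \int[nu]_(x in [set x : R | 1 < `|x| <= eps]) x.

Definition moment_upto (nu : {measure set R -> \bar R}) (k : nat) (eps : R) : R :=
  \int[nu]_(x in [set x : R | `|x| <= eps]) (x ^+ k).

Definition variance_upto (nu : {measure set R -> \bar R}) (eps : R) : R :=
  moment_upto nu 2 eps.

Definition intensity (nu : {measure set R -> \bar R}) (eps : R) : \bar R :=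
  nu [set x : R | 0 < `|x| <= eps].

End Levy.

Section ProductLaw.
Context d (T : measurableType d) (R : realType).

Definition tcons n (x : T * n.-tuple T) : n.+1.-tuple T :=
  [the n.+1.-tuple T of x.1 :: x.2].

Lemma measurable_tcons n : measurable_fun [set: T * n.-tuple T] (@tcons n).
Proof. exact: measurable_cons. Qed.

HB.instance Definition _ n :=
  isMeasurableFun.Build _ _ _ _ (@tcons n) (@measurable_tcons n).

(* Joint law of [n] i.i.d. random elements with law [P]. *)
Fixpoint iid_law (P : probability T R) (n : nat) : probability (n.-tuple T) R :=
  if n is m.+1
  then distribution (P \x iid_law P m)%E (@tcons m)
  else \d_([tuple] : 0.-tuple T).

Lemma iid_law_rect (P : probability T R) n (B : 'I_n -> set T) :
  (forall i, measurable (B i)) ->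
  iid_law P n [set x | forall i, B i (tnth x i)] = (\prod_(i < n) P (B i))%E.
Proof.
elim: n B => [B _|n IH B mB] /=.
  rewrite big_ord0 diracE mem_set//=; by case.
rewrite big_ord_recl.
have mQ : measurable [set y : n.-tuple T | forall i : 'I_n, B (lift ord0 i) (tnth y i)].
  rewrite (_ : mkset _ = \big[setI/setT]_(i < n) [set y | B (lift ord0 i) (tnth y i)]); last first.
    apply/seteqP; split => y /=.
      by move=> H; elim/big_ind : _ => //= i _; exact: H.
    by move=> H i; move: H; rewrite (bigD1 i)//= => -[].
  apply: bigsetI_measurable => i _.
  by rewrite -[X in measurable X]setTI; apply: measurable_tnth.
rewrite -IH; last by [].
rewrite -product_measure1E//.
rewrite /distribution/= /pushforward; congr (product_measure1 _ _ _).
apply/seteqP; split => -[x y] /=.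
  move=> H; split; first by have := H ord0; rewrite tnth0.
  by move=> i; have := H (lift ord0 i); rewrite tnthS.
move=> [H1 H2] i; case: (unliftP ord0 i) => [j ->|->]; first by rewrite tnthS; exact: H2.
by rewrite tnth0.
Qed.

End ProductLaw.

Definition tv_dist d (T : measurableType d) (R : realType)
    (P Q : probability T R) : \bar R :=
  ereal_sup [set `|P B - Q B|%E | B in measurable].

(* [normal_prob] lives on [measurableTypeR R], which has the same Borel
   sigma-algebra as [R] but another display; the identity transports it. *)
Section GaussLaw.
Context {R : realType}.

Let idR : measurableTypeR R -> R := idfun.

Let measurable_idR : measurable_fun setT idR.
Proof. exact: (@measurable_id _ (measurableTypeR R) setT). Qed.

HB.instance Definition _ := isMeasurableFun.Build _ _ _ _ idR measurable_idR.

(* The Gaussian law with mean [m] and variance [v > 0]; [normal_prob] takes a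
   standard deviation, and is not a Dirac mass when the latter is [0]. *)
Definition gauss_law (m v : R) : probability R R :=
  distribution (normal_prob m (Num.sqrt v)) idR.

Lemma gauss_lawE (m v : R) (B : set R) :
  gauss_law m v B = normal_prob m (Num.sqrt v) B.
Proof. by []. Qed.

End GaussLaw.

(* Quotient of reals with the convention [x / 0 = +oo]. *)
Definition quot_infty {R : realType} (x y : R) : \bar R :=
  if y == 0 then +oo%E else (x / y)%:E.

Definition logmax {R : realType} (n : nat) : R := ln (Num.max (expR 1) n%:R).

(* Main.v *)
Require Import Defs.
From HB Require Import structures.
From mathcomp Require Import all_boot all_order all_algebra.
From mathcomp Require Import all_classical all_reals all_analysis.
From mathcomp Require Import measurable_realfun complex ring lra.

Set Implicit Arguments.
Unset Strict Implicit.
Unset Printing Implicit Defensive.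

Import Order.TTheory GRing.Theory Num.Theory.
Import numFieldNormedType.Exports.

Local Open Scope classical_set_scope.
Local Open Scope ring_scope.

(** The two laws are told apart by Chebyshev tests built on the empirical third and
    fourth centred moments. Put [v = Delta (Sigma^2 + sigma^2(eps))] and
    [k_j = Delta mu_j(eps)]: the variable [Y = X_Delta(eps) - b(eps) Delta] has mean
    [0], variance [v] and higher cumulants [k_j], so that [E Y^3 = k_3] and
    [E Y^4 = k_4 + 3 v^2], against [0] and [3 v^2] for the Gaussian law. With [n]
    observations, a test comparing the empirical mean of a statistic [f] with its
    expectations under the two laws errs with probability at most
    [4 (E_P f^2 + E_Q f^2) / (n (E_P f - E_Q f)^2)] ([tv_dist_iid_ge]).

    The second moments of these statistics involve the cumulants up to order 8. As the
    jumps are at most [eps <= sqrt v L^2], with [L = log (e \/ n)], all cumulants of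
    order above 4 are controlled by [k_4]. For the fourth moment this gives an error
    bounded by a multiple of [v^4 / (n k_4^2) + L^8 v^2 / (n k_4)], whose second term
    is at most the mean of the first and of [L^16 / n] ([fourth_moment_test]). For the
    third moment, either [L^4 k_4 <= v^2], and then [E Y^6] is of the Gaussian order
    [v^3], or [k_4] is so large that the fourth-moment test alone errs with a
    probability of order [L^16 / n] ([third_moment_test]). This last quantity is the
    vanishing sequence of the theorem.

    The law of [X_Delta] is only known through a characteristic function, and the
    existence of its moments would have to be proved. Powers [Y^p] are therefore
    replaced by the bounded statistics [(sin (t Y) / t)^p] ([sine_power]), whose
    expectations are linear combinations of values of the characteristic function; as
    [t] tends to [0] they tend to the moments predicted by the cumulants, because the
    logarithm of the characteristic function has a Taylor expansion of order 8 at the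
    origin ([cumulants_upto8]), and the bound passes to the limit
    ([sine_power_tv_dist_ge]).

    Two characteristic functions are needed. That of the Gaussian law solves
    [phi' = - t v phi], by comparing translations of the law with exponential tilts
    ([gauss_law_cumulants]). That of [X_Delta] is deduced from the one of [X_1], which
    the triplet gives: independence and stationarity of the increments make it
    multiplicative in time, continuity in the frequency selects the right square roots
    at dyadic times, and stochastic continuity reaches every time
    ([levy_process_exponent]). *)

(** * Bounded statistics and product laws *)

Section BoundedMeasurable.
Context d (T : measurableType d) (R : realType).
Implicit Types (f g : T -> R) (P : probability T R).

Definition bounded_measurable f : Prop :=
  measurable_fun setT f /\ exists K : R, forall x, `|f x| <= K.

Lemma bounded_measurable_integrable P f :
  bounded_measurable f -> P.-integrable setT (EFin \o f).
Proof.
move=> [mf [K fK]]; apply: measurable_bounded_integrable => //.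
  by rewrite -ge0_fin_numE// fin_num_measure.
exists K; split; first exact: num_real.
by move=> y Ky x _; exact: le_trans (fK x) (ltW Ky).
Qed.

Lemma bounded_measurable_cst c : bounded_measurable (fun=> c : R).
Proof. by split; [exact: measurable_cst|exists `|c|]. Qed.

Lemma bounded_measurableD f g : bounded_measurable f -> bounded_measurable g ->
  bounded_measurable (fun x => f x + g x).
Proof.
move=> [mf [K fK]] [mg [L gL]]; split; first exact: measurable_funD.
by exists (K + L) => x; rewrite (le_trans (ler_normD _ _))// lerD.
Qed.

Lemma bounded_measurableM f g : bounded_measurable f -> bounded_measurable g ->
  bounded_measurable (fun x => f x * g x).
Proof.
move=> [mf [K fK]] [mg [L gL]]; split; first exact: measurable_funM.
by exists (K * L) => x; rewrite normrM ler_pM.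
Qed.

Lemma bounded_measurableZ c f :
  bounded_measurable f -> bounded_measurable (fun x => c * f x).
Proof. by apply: bounded_measurableM; exact: bounded_measurable_cst. Qed.

Lemma bounded_measurableB f g : bounded_measurable f -> bounded_measurable g ->
  bounded_measurable (fun x => f x - g x).
Proof.
move=> [mf [K fK]] [mg [L gL]]; split; first exact: measurable_funB.
by exists (K + L) => x; rewrite (le_trans (ler_normB _ _))// lerD.
Qed.

Lemma bounded_measurableX f n :
  bounded_measurable f -> bounded_measurable (fun x => f x ^+ n).
Proof.
move=> bf; elim: n => [|n IH].
  under eq_fun do rewrite expr0; exact: bounded_measurable_cst.
by under eq_fun do rewrite exprS; exact: bounded_measurableM.
Qed.

Lemma prob_Rintegral_cst P (c : R) : \int[P]_x c = c.
Proof. by rewrite Rintegral_cst//= probability_setT mulr1. Qed.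

Lemma prob_RintegralD P f g : bounded_measurable f -> bounded_measurable g ->
  \int[P]_x (f x + g x) = \int[P]_x f x + \int[P]_x g x.
Proof. by move=> bf bg; rewrite RintegralD//; exact: bounded_measurable_integrable. Qed.

Lemma prob_RintegralB P f g : bounded_measurable f -> bounded_measurable g ->
  \int[P]_x (f x - g x) = \int[P]_x f x - \int[P]_x g x.
Proof. by move=> bf bg; rewrite RintegralB//; exact: bounded_measurable_integrable. Qed.

Lemma prob_RintegralZ P c f : bounded_measurable f ->
  \int[P]_x (c * f x) = c * \int[P]_x f x.
Proof. by move=> bf; rewrite RintegralZl//; exact: bounded_measurable_integrable. Qed.

Lemma prob_Rintegral_le P f g : bounded_measurable f -> bounded_measurable g ->
  (forall x, f x <= g x) -> \int[P]_x f x <= \int[P]_x g x.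
Proof.
by move=> bf bg fg; apply: le_Rintegral => //; exact: bounded_measurable_integrable.
Qed.

Lemma EFin_prob_Rintegral P f : bounded_measurable f ->
  (\int[P]_x f x)%:E = (\int[P]_x (f x)%:E)%E.
Proof.
move=> bf; rewrite fineK//.
by apply: integrable_fin_num => //; exact: bounded_measurable_integrable.
Qed.

Lemma measurable_norm_ge f (r : R) : measurable_fun setT f ->
  measurable [set x | r <= `|f x|].
Proof.
move=> mf; have mnf : measurable_fun setT (fun x => `|f x|) by exact: measurableT_comp.
rewrite (_ : mkset _ = setT `&` (fun x => `|f x|) @^-1` `[r, +oo[); first exact: mnf.
by apply/seteqP; split => x /=; rewrite in_itv/= andbT// => -[].
Qed.

Lemma bounded_chebyshev P f (r : R) : bounded_measurable f -> 0 < r ->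
  (P [set x | (r <= `|f x|)%R] <= (\int[P]_x (f x ^+ 2) / r ^+ 2)%:E)%E.
Proof.
move=> bf r0; have [mf _] := bf.
have mA : measurable [set x | r <= `|f x|] by exact: measurable_norm_ge.
have bA : bounded_measurable (\1_[set x | r <= `|f x|] : T -> R).
  split; first exact: measurable_indic.
  by exists 1 => x; rewrite indicE; case: (_ \in _); rewrite ?normr1 ?normr0.
have -> : P [set x | r <= `|f x|] = (\int[P]_x (\1_[set x | r <= `|f x|] x : R))%:E.
  by rewrite EFin_prob_Rintegral// integral_indic//= setIT.
rewrite lee_fin ler_pdivlMr ?exprn_gt0// mulrC -prob_RintegralZ//.
apply: prob_Rintegral_le.
- exact: bounded_measurableZ.
- exact: bounded_measurableX.
move=> x; rewrite indicE; case: (boolP (x \in _)) => [|_] /=; last by rewrite mulr0 sqr_ge0.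
by rewrite inE/= mulr1 => rf; rewrite -(real_normK (num_real (f x))) lerXn2r// nnegrE ltW.
Qed.

End BoundedMeasurable.

Section BoundedTransport.
Context d1 d2 (T1 : measurableType d1) (T2 : measurableType d2) (R : realType).

Lemma bounded_measurable_comp (f : T2 -> R) (g : T1 -> T2) :
  bounded_measurable f -> measurable_fun setT g ->
  bounded_measurable (fun x => f (g x)).
Proof.
move=> [mf [K fK]] mg; split; first exact: measurableT_comp.
by exists K.
Qed.

Lemma Rintegral_distribution (P : probability T1 R) (X : {RV P >-> T2})
    (f : T2 -> R) : bounded_measurable f ->
  \int[distribution P X]_y f y = \int[P]_w f (X w).
Proof.
move=> bf; rewrite /Rintegral integral_distribution//.
- by apply/measurable_EFinP; case: bf.
- by apply: bounded_measurable_integrable; exact: bounded_measurable_comp.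
Qed.

End BoundedTransport.

Lemma Rintegral_prod d1 d2 (T1 : measurableType d1) (T2 : measurableType d2)
    (R : realType) (P : probability T1 R) (Q : probability T2 R)
    (f : T1 * T2 -> R) : bounded_measurable f ->
  \int[(P \x Q)%E]_z f z = \int[P]_x \int[Q]_y f (x, y).
Proof.
move=> bf; rewrite /Rintegral -integral12_prod_meas1/=; last first.
  exact: (bounded_measurable_integrable (P \x Q)%E bf).
congr fine; apply: eq_integral => x _.
rewrite /fubini_F EFin_prob_Rintegral//.
apply: (bounded_measurable_comp (g := pair x) bf).
exact: pair1_measurable.
Qed.

Section IidTest.
Context d (T : measurableType d) (R : realType).
Implicit Types (f : T -> R) (P Q : probability T R).

Definition sample_sum f n (x : n.-tuple T) : R := \sum_(i < n) f (tnth x i).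

Lemma sample_sum_bounded f n : bounded_measurable f ->
  bounded_measurable (@sample_sum f n).
Proof.
move=> bf; rewrite /sample_sum; elim: (index_enum _) => [|i s IH].
  by under eq_fun do rewrite big_nil; exact: bounded_measurable_cst.
under eq_fun do rewrite big_cons; apply: bounded_measurableD => //.
by apply: bounded_measurable_comp => //; exact: measurable_tnth.
Qed.

Lemma sample_sumS f n (z : T * n.-tuple T) :
  sample_sum f (tcons z) = f z.1 + sample_sum f z.2.
Proof.
case: z => x y.
rewrite /sample_sum big_ord_recl; congr (_ + _); apply: eq_bigr => i _.
by rewrite tnthS.
Qed.

Lemma Rintegral_iid_lawS P n (g : n.+1.-tuple T -> R) : bounded_measurable g ->
  \int[iid_law P n.+1]_x g x = \int[P]_x \int[iid_law P n]_y g (tcons (x, y)).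
Proof.
move=> bg; rewrite [LHS]Rintegral_distribution//.
apply: (Rintegral_prod P (iid_law P n)).
by apply: bounded_measurable_comp => //; exact: measurable_tcons.
Qed.

(** The recursive definition of the joint law turns the classical additivity of
    variances into a Fubini computation, in which the cross term vanishes. *)
Lemma iid_sample_sum P f n : bounded_measurable f -> \int[P]_x f x = 0 ->
  \int[iid_law P n]_x sample_sum f x = 0 /\
  \int[iid_law P n]_x sample_sum f x ^+ 2 = n%:R * \int[P]_x f x ^+ 2.
Proof.
move=> bf f0; elim: n => [|n [IH1 IH2]].
  have E x : @sample_sum f 0 x = 0 by rewrite /sample_sum big_ord0.
  split; under eq_Rintegral do rewrite E.
    exact: (prob_Rintegral_cst (iid_law P 0)).
  by rewrite expr0n/= mul0r; exact: (prob_Rintegral_cst (iid_law P 0)).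
have bS m := sample_sum_bounded m bf.
split; rewrite Rintegral_iid_lawS//; last exact/bounded_measurableX/bS.
  rewrite -f0; apply: eq_Rintegral => x _.
  transitivity (\int[iid_law P n]_y (f x + sample_sum f y)).
    by apply: eq_Rintegral => y _; rewrite sample_sumS.
  rewrite prob_RintegralD; last 2 first.
  - exact: bounded_measurable_cst.
  - exact: bS.
  by rewrite prob_Rintegral_cst IH1 addr0.
transitivity (\int[P]_x (f x ^+ 2 + n%:R * \int[P]_x f x ^+ 2)).
  apply: eq_Rintegral => x _.
  transitivity (\int[iid_law P n]_y
      ((f x ^+ 2 + sample_sum f y ^+ 2) + 2 * f x * sample_sum f y)).
    by apply: eq_Rintegral => y _; rewrite sample_sumS/=; ring.
  rewrite prob_RintegralD; last 2 first.
  - apply: bounded_measurableD; first exact: bounded_measurable_cst.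
    exact/bounded_measurableX/bS.
  - exact/bounded_measurableZ/bS.
  rewrite prob_RintegralD; last 2 first.
  - exact: bounded_measurable_cst.
  - exact/bounded_measurableX/bS.
  rewrite [X in _ + X]prob_RintegralZ; last exact: bS.
  rewrite [X in _ + _ * X](_ : _ = 0) ?mulr0 ?addr0; last exact: IH1.
  by rewrite prob_Rintegral_cst; congr (_ + _); exact: IH2.
rewrite prob_RintegralD; last 2 first.
- exact: bounded_measurableX.
- exact: bounded_measurable_cst.
by rewrite prob_Rintegral_cst -[n.+1%:R]natr1 mulrDl mul1r addrC.
Qed.

Lemma iid_chebyshev P f n (r : R) : bounded_measurable f -> 0 < r ->
  (iid_law P n [set x | (r <= `|sample_sum f x - n%:R * \int[P]_x f x|)%R]
   <= (n%:R * (\int[P]_x f x ^+ 2) / r ^+ 2)%:E)%E.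
Proof.
move=> bf r0; set m := \int[P]_x f x.
pose g x := f x - m.
have bg : bounded_measurable g.
  by apply: bounded_measurableB => //; exact: bounded_measurable_cst.
have g0 : \int[P]_x g x = 0.
  by rewrite prob_RintegralB ?prob_Rintegral_cst ?subrr//; exact: bounded_measurable_cst.
have Sg x : @sample_sum f n x - n%:R * m = sample_sum g x.
  by rewrite /sample_sum sumrB sumr_const card_ord mulr_natl.
under eq_set do rewrite Sg.
have [_ Sg2] := iid_sample_sum n bg g0.
have := bounded_chebyshev (iid_law P n) (sample_sum_bounded n bg) r0.
move=> /le_trans; apply; rewrite lee_fin ler_pM2r ?invr_gt0 ?exprn_gt0// [leLHS]Sg2.
rewrite ler_wpM2l//.
have -> : \int[P]_x g x ^+ 2 = \int[P]_x (f x ^+ 2 - (m * 2 * f x - m ^+ 2)).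
  by apply: eq_Rintegral => x _; rewrite /g; ring.
have bl : bounded_measurable (fun x => m * 2 * f x - m ^+ 2).
  by apply: bounded_measurableB; [exact: bounded_measurableZ|exact: bounded_measurable_cst].
rewrite prob_RintegralB//; last exact: bounded_measurableX.
rewrite prob_RintegralB; last 2 first.
- exact: bounded_measurableZ.
- exact: bounded_measurable_cst.
rewrite prob_RintegralZ// prob_Rintegral_cst -/m.
by have := sqr_ge0 m; lra.
Qed.

(** The event that the empirical mean of [f] lies within half of the gap between the
    two expectations from the one under [P] is likely under [P]; since it forces a
    deviation of half of the gap from the expectation under [Q], it is unlikely under
    [Q]. *)
Lemma tv_dist_iid_ge P Q f n : bounded_measurable f -> (0 < n)%N ->
  \int[P]_x f x != \int[Q]_x f x ->
  ((1 - 4 * (\int[P]_x f x ^+ 2 + \int[Q]_x f x ^+ 2) /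
        (n%:R * (\int[P]_x f x - \int[Q]_x f x) ^+ 2))%:E
   <= tv_dist (iid_law P n) (iid_law Q n))%E.
Proof.
move=> bf n0; set p := \int[P]_x f x; set q := \int[Q]_x f x => pq.
have nR : (0 : R) < n%:R by rewrite ltr0n.
pose r := n%:R * `|p - q| / 2.
have r0 : 0 < r by rewrite divr_gt0// mulr_gt0// normr_gt0 subr_eq0.
pose A (c : R) := [set x : n.-tuple T | r <= `|sample_sum f x - n%:R * c|].
have mA c : measurable (A c).
  apply: measurable_norm_ge; apply: measurable_funB => //.
  by case: (sample_sum_bounded n bf).
have PA : (iid_law P n (A p) <= (n%:R * (\int[P]_x f x ^+ 2) / r ^+ 2)%:E)%E.
  exact: iid_chebyshev.
have QA : (iid_law Q n (~` A p) <= (n%:R * (\int[Q]_x f x ^+ 2) / r ^+ 2)%:E)%E.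
  apply: le_trans (iid_chebyshev Q n bf r0); apply: le_measure; rewrite ?inE//.
  - exact: measurableC.
  - exact: mA.
  move=> x /=; rewrite /A/= => /negP; rewrite -ltNge => xp.
  have rE : r * 2 = `|n%:R * p - n%:R * q|.
    by rewrite /r divfK// -mulrBr normrM (ger0_norm (ler0n R n)).
  have := ler_normD (n%:R * p - sample_sum f x) (sample_sum f x - n%:R * q).
  by rewrite subrKA -rE distrC -/q; lra.
have mB : measurable (~` A p) by exact: measurableC.
apply: (@le_trans _ _ (`|iid_law P n (~` A p) - iid_law Q n (~` A p)|)%E); last first.
  by apply: ereal_sup_ubound; exists (~` A p).
have finP : iid_law P n (A p) \is a fin_num by exact: fin_num_measure.
have finQ : iid_law Q n (~` A p) \is a fin_num by exact: fin_num_measure.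
apply: le_trans (lee_abs _).
rewrite [iid_law P n _]probability_setC//.
move: PA QA; rewrite -(fineK finP) -(fineK finQ) !lee_fin => PA QA.
have -> : 4 * (\int[P]_x f x ^+ 2 + \int[Q]_x f x ^+ 2) / (n%:R * (p - q) ^+ 2) =
  n%:R * \int[P]_x f x ^+ 2 / r ^+ 2 + n%:R * \int[Q]_x f x ^+ 2 / r ^+ 2.
  rewrite /r -(real_normK (num_real (p - q))).
  have : `|p - q| != 0 by rewrite normr_eq0 subr_eq0.
  by move=> pq0; field; rewrite pq0 gt_eqF.
by move: PA QA; lra.
Qed.

End IidTest.

(** * Taylor remainders of the sine, the cosine and the exponential *)

Section Taylor.
Context {R : realType}.
Implicit Types (f F G : R -> R) (x y K M : R).

(** Integrating a power bound once: each Taylor remainder below is, up to sign, the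
    derivative of the next one. *)
Lemma remainder_step F G K M k :
  (forall x, is_derive x 1 F (G x)) -> F 0 = 0 ->
  (forall x, `|x| <= M -> `|G x| <= K * `|x| ^+ k) ->
  forall x, `|x| <= M -> `|F x| <= K * `|x| ^+ k.+1.
Proof.
move=> dF F0 GK x xM.
have cF a b : {within `[a, b], continuous F}.
  apply: derivable_within_continuous => y _.
  by have [] := dF y.
have bnd c : `|c| <= `|x| -> `|G c * x| <= K * `|x| ^+ k.+1.
  move=> cx; rewrite normrM exprSr mulrA ler_wpM2r//.
  have K0 : 0 <= K * `|c| ^+ k.
    exact: le_trans (normr_ge0 _) (GK _ (le_trans cx xM)).
  apply: le_trans (GK _ (le_trans cx xM)) _.
  have [c0|c0] := eqVneq c 0; last first.
    rewrite ler_wpM2l ?lerXn2r ?nnegrE//.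
    by move: K0; rewrite pmulr_lge0// exprn_gt0// normr_gt0.
  rewrite c0 normr0; case: k GK {K0} => [|k] GK; first by rewrite !expr0.
  by rewrite expr0n/= mulr0; exact: le_trans (normr_ge0 _) (GK _ xM).
have [x0|x0] := leP 0 x.
  have [c] := MVT_segment x0 (fun y _ => dF y) (cF _ _).
  rewrite in_itv/= => /andP[c0 cx]; rewrite F0 !subr0 => ->.
  by apply: bnd; rewrite !ger0_norm.
have [c] := MVT_segment (ltW x0) (fun y _ => dF y) (cF _ _).
rewrite in_itv/= => /andP[xc c0]; rewrite F0 !sub0r => FE.
rewrite -normrN FE mulrN normrN; apply: bnd.
by rewrite !ler0_norm ?lerN2// ltW.
Qed.

(** Stated for a whole sequence of successive derivatives, so that the induction on the
    order shifts the sequence; the remainder of order [0] is the bound [K] itself. *)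
Lemma taylor_remainder (D : nat -> R -> R) K M :
  (forall k x, is_derive x 1 (D k) (D k.+1 x)) ->
  (forall k x, `|x| <= M -> `|D k x| <= K) ->
  forall n k x, `|x| <= M ->
    `|D k x - \sum_(i < n) D (k + i)%N 0 / i`!%:R * x ^+ i| <= K * `|x| ^+ n.
Proof.
move=> dD bD; pose p n k := \poly_(i < n) (D (k + i)%N 0 / i`!%:R).
have pE n k x : \sum_(i < n) D (k + i)%N 0 / i`!%:R * x ^+ i = (p n k).[x].
  by rewrite horner_poly.
elim=> [|n IH] k x xM.
  by rewrite big_ord0 subr0 expr0 mulr1 bD.
rewrite pE; apply: (@remainder_step (fun x => D k x - (p n.+1 k).[x])
  (fun x => D k.+1 x - (p n k.+1).[x]) K M n) => // [{x xM}x||{x xM}x xM].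
- have -> : p n k.+1 = (p n.+1 k)^`().
    apply/polyP => i; rewrite coef_deriv !coef_poly ltnS.
    case: ifP => _; last by rewrite mul0rn.
    rewrite addnS addSn factS natrM -[RHS]mulr_natr.
    have j0 : i.+1%:R != 0 :> R by rewrite pnatr_eq0.
    have f0 : i`!%:R != 0 :> R by rewrite pnatr_eq0 -lt0n fact_gt0.
    by move: (i.+1%:R) (i`!%:R) j0 f0 => j f j0 f0; field; rewrite j0 f0.
  by apply: is_deriveB; exact: is_derive_poly.
- rewrite horner_poly big_ord_recl/= addn0 fact0 divr1 expr0 mulr1 big1 ?addr0 ?subrr//.
  by move=> i _; rewrite expr0n/= mulr0.
- by rewrite -pE; exact: IH.
Qed.

Fixpoint cos_deriv k x := match k with
  | 0 => cos x | 1 => - sin x | 2 => - cos x | 3 => sin x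
  | k'.+4 => cos_deriv k' x
  end.

Lemma cos_derivP k x : is_derive x 1 (cos_deriv k) (cos_deriv k.+1 x).
Proof.
suff : [/\ is_derive x 1 (cos_deriv k) (cos_deriv k.+1 x),
    is_derive x 1 (cos_deriv k.+1) (cos_deriv k.+2 x),
    is_derive x 1 (cos_deriv k.+2) (cos_deriv k.+3 x) &
    is_derive x 1 (cos_deriv k.+3) (cos_deriv k x)] by case.
elim: k => [|k [? ? ? ?]]; last by split.
split; [exact: is_derive_cos| | |exact: is_derive_sin].
- by apply: is_deriveN; exact: is_derive_sin.
- by rewrite /= -[X in is_derive _ _ _ X]opprK; apply: is_deriveN; exact: is_derive_cos.
Qed.

Lemma cos_deriv_le1 k x : `|cos_deriv k x| <= 1.
Proof.
suff : [/\ `|cos_deriv k x| <= 1, `|cos_deriv k.+1 x| <= 1,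
  `|cos_deriv k.+2 x| <= 1 & `|cos_deriv k.+3 x| <= 1] by case.
elim: k => [|k [? ? ? ?]]; last by split.
by split; rewrite ?normrN ?cos_max ?sin_max.
Qed.

Let cos_deriv_remainder n k x :
  `|cos_deriv k x - \sum_(i < n) cos_deriv (k + i) 0 / i`!%:R * x ^+ i|
  <= `|x| ^+ n.
Proof.
rewrite -[leRHS]mul1r.
apply: (taylor_remainder cos_derivP (M := `|x|) (K := 1)) => // j y _.
exact: cos_deriv_le1.
Qed.

Lemma cos_remainder1 x : `|cos x - 1| <= `|x|.
Proof.
have := cos_deriv_remainder 1 0 x; rewrite !big_ord_recl big_ord0/= cos0.
by congr (`|_| <= _); rewrite !fact0; field.
Qed.

Lemma cos_remainder2 x : `|cos x - 1| <= `|x| ^+ 2.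
Proof.
have := cos_deriv_remainder 2 0 x; rewrite !big_ord_recl big_ord0/= sin0 cos0.
by congr (`|_| <= _); rewrite /bump !leq0n !add1n !factS !fact0; field.
Qed.

Lemma cos_remainder3 x : `|cos x - (1 - x ^+ 2 / 2)| <= `|x| ^+ 3.
Proof.
have := cos_deriv_remainder 3 0 x; rewrite !big_ord_recl big_ord0/= sin0 cos0.
by congr (`|_| <= _); rewrite /bump !leq0n !add1n !factS !fact0; field.
Qed.

Lemma cos_remainder9 x :
  `|cos x - (1 - x ^+ 2 / 2 + x ^+ 4 / 24 - x ^+ 6 / 720 + x ^+ 8 / (56 * 720))|
  <= `|x| ^+ 9.
Proof.
have := cos_deriv_remainder 9 0 x; rewrite !big_ord_recl big_ord0/= sin0 cos0.
by congr (`|_| <= _); rewrite /bump !leq0n !add1n !factS !fact0; field.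
Qed.

Lemma sin_remainder1 x : `|sin x| <= `|x|.
Proof.
have := cos_deriv_remainder 1 3 x; rewrite !big_ord_recl big_ord0/= sin0.
by congr (`|_| <= _); rewrite !fact0; field.
Qed.

Lemma sin_remainder2 x : `|sin x - x| <= `|x| ^+ 2.
Proof.
have := cos_deriv_remainder 2 3 x; rewrite !big_ord_recl big_ord0/= sin0 cos0.
by congr (`|_| <= _); rewrite /bump !leq0n !add1n !factS !fact0; field.
Qed.

Lemma sin_remainder6 x :
  `|sin x - (x - x ^+ 3 / 6 + x ^+ 5 / 120)| <= `|x| ^+ 6.
Proof.
have := cos_deriv_remainder 6 3 x; rewrite !big_ord_recl big_ord0/= sin0 cos0.
by congr (`|_| <= _); rewrite /bump !leq0n !add1n !factS !fact0; field.
Qed.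

Lemma expR_remainder n x : `|x| <= 1 ->
  `|expR x - \sum_(i < n) x ^+ i / i`!%:R| <= expR 1 * `|x| ^+ n.
Proof.
move=> x1.
have := taylor_remainder (D := fun _ => @expR R) (M := 1) (K := expR 1).
move=> /(_ (fun _ => @is_derive_expR R) _ n 0%N x x1).
rewrite (eq_bigr (fun i : 'I_n => x ^+ i / i`!%:R)) => [|i _]; last first.
  by rewrite expR0 mul1r mulrC.
apply=> _ y y1; rewrite ger0_norm ?expR_ge0// ler_expR.
exact: le_trans (ler_norm _) y1.
Qed.

Lemma expR_remainder5 x : `|x| <= 1 ->
  `|expR x - (1 + x + x ^+ 2 / 2 + x ^+ 3 / 6 + x ^+ 4 / 24)|
  <= expR 1 * `|x| ^+ 5.
Proof.
move=> /(expR_remainder 5); rewrite !big_ord_recl big_ord0/=.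
by congr (`|_| <= _); rewrite /bump !leq0n !add1n !factS !fact0; field.
Qed.

End Taylor.

(** * Expansions at the origin *)

Section BigO.
Context {R : realType}.
Implicit Types (f g : R -> R) (k : nat) (c l : R).

Definition isO k f : Prop :=
  exists K : R, \forall t \near (0 : R), `|f t| <= K * `|t| ^+ k.

Lemma isO_ext k f g : (forall t, f t = g t) -> isO k g -> isO k f.
Proof. by move=> fg [K ?]; exists K; near do rewrite fg. Unshelve. all: by end_near. Qed.

Lemma isO_bound k f g (K : R) :
  (\forall t \near (0 : R), `|f t| <= K * `|g t|) -> isO k g -> isO k f.
Proof.
move=> fg [L gL]; exists (`|K| * L); near=> t.
have fgt : `|f t| <= K * `|g t| by near: t.
apply: le_trans fgt _; rewrite -mulrA.
apply: (@le_trans _ _ (`|K| * `|g t|)); first by rewrite ler_wpM2r// ler_norm.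
by rewrite ler_wpM2l//; near: t.
Unshelve. all: by end_near. Qed.

Lemma isOD k f g : isO k f -> isO k g -> isO k (fun t => f t + g t).
Proof.
move=> [K fK] [L gL]; exists (K + L); near=> t.
rewrite (le_trans (ler_normD _ _))// mulrDl lerD//; by near: t.
Unshelve. all: by end_near. Qed.

Lemma isOM j k f g : isO j f -> isO k g -> isO (j + k) (fun t => f t * g t).
Proof.
move=> [K fK] [L gL]; exists (K * L); near=> t.
by rewrite normrM exprD mulrACA ler_pM//; near: t.
Unshelve. all: by end_near. Qed.

Lemma isO_le j k f : (j <= k)%N -> isO k f -> isO j f.
Proof.
move=> jk [K fK]; exists `|K|; near=> t.
have fKt : `|f t| <= K * `|t| ^+ k by near: t.
apply: le_trans fKt _; apply: (@le_trans _ _ (`|K| * `|t| ^+ k)).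
  by rewrite ler_wpM2r// ler_norm.
have t1 : `|t| <= 1 by near: t; exact: (@cvgr0_norm_le _ _ _ _ _ id).
by rewrite ler_wpM2l// ler_wiXn2l.
Unshelve. all: by end_near. Qed.

Lemma isO_cst c : isO 0 (fun=> c).
Proof.
by exists `|c|; near=> t; rewrite expr0 mulr1.
Unshelve. all: by end_near. Qed.

Lemma isO_Xn k : isO k (fun t => t ^+ k).
Proof.
by exists 1; near=> t; rewrite mul1r normrX.
Unshelve. all: by end_near. Qed.

Lemma isO_XnM k f : isO 0 f -> isO k (fun t => t ^+ k * f t).
Proof. by move=> f0; have := isOM (isO_Xn k) f0; rewrite addn0. Qed.

Lemma isOZ k c f : isO k f -> isO k (fun t => c * f t).
Proof. by move=> fk; apply: (isOM (isO_cst c) fk). Qed.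

Lemma isON k f : isO k f -> isO k (fun t => - f t).
Proof. by move=> fk; apply: isO_ext (isOZ (-1) fk) => t; rewrite mulN1r. Qed.

Lemma isOB k f g : isO k f -> isO k g -> isO k (fun t => f t - g t).
Proof. by move=> fk /isON; exact: isOD. Qed.

Lemma isO0M f g : isO 0 f -> isO 0 g -> isO 0 (fun t => f t * g t).
Proof. exact: isOM. Qed.

Lemma isO0X f n : isO 0 f -> isO 0 (fun t => f t ^+ n).
Proof.
move=> f0; elim: n => [|n IH].
  by apply: isO_ext (isO_cst 1) => t; rewrite expr0.
by apply: isO_ext (isO0M f0 IH) => t; rewrite exprS.
Qed.

Lemma isO0_id : isO 0 (fun t => t).
Proof. by apply: (@isO_le 0 1) => //; apply: isO_ext (isO_Xn 1) => t; rewrite expr1. Qed.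

Lemma isO_scale k c f : isO k f -> isO k (fun t => f (c * t)).
Proof.
move=> [K fK]; exists (K * `|c| ^+ k).
have c0 : c * t @[t --> (0 : R)] --> (0 : R).
  by rewrite -[X in _ --> X](mulr0 c); apply: cvgM; [exact: cvg_cst|exact: cvg_id].
have fK' : \forall t \near (0 : R), `|f (c * t)| <= K * `|c * t| ^+ k by exact: c0 fK.
near=> t; rewrite -mulrA -exprMn -normrM; near: t; exact: fK'.
Unshelve. all: by end_near. Qed.

Lemma isO_cvg k f l : isO k.+1 (fun t => f t - l * t ^+ k) ->
  f t / t ^+ k @[t --> 0^'] --> l.
Proof.
move=> [K fK]; apply/cvgrPdist_le => e e0.
have K0 : 0 < `|K| + 1 by rewrite ltr_wpDl.
have {}fK : \forall t \near (0 : R)^', `|f t - l * t ^+ k| <= K * `|t| ^+ k.+1.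
  exact: (@nbhs_dnbhs _ (0 : R) _ fK).
have smallt : \forall t \near (0 : R), `|t| <= e / (`|K| + 1).
  have e1 : 0 < e / (`|K| + 1) by rewrite divr_gt0.
  near=> t; near: t; move: e1; exact: (@cvgr0_norm_le _ _ _ _ _ id).
have {}smallt : \forall t \near (0 : R)^', `|t| <= e / (`|K| + 1).
  exact: (@nbhs_dnbhs _ (0 : R) _ smallt).
near=> t.
have t0 : t != 0 by near: t; exact: nbhs_dnbhs_neq.
have ft : `|f t - l * t ^+ k| <= K * `|t| ^+ k.+1.
  by near: t.
have te : `|t| <= e / (`|K| + 1) by near: t.
have tk : 0 < `|t| ^+ k by rewrite exprn_gt0// normr_gt0.
rewrite distrC.
have -> : f t / t ^+ k - l = (f t - l * t ^+ k) / t ^+ k.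
  by field; rewrite expf_neq0.
rewrite normrM normfV normrX ler_pdivrMr//.
apply: le_trans ft _; rewrite exprS mulrA; apply: ler_wpM2r; first exact: ltW.
apply: (@le_trans _ _ ((`|K| + 1) * `|t|)).
  by rewrite ler_wpM2r// (le_trans (ler_norm _))// lerDl.
by rewrite mulrC -ler_pdivlMr.
Unshelve. all: by end_near. Qed.

End BigO.

(** Bounds a polynomial expression near [0] by recursion on its syntax. *)
Ltac isO0 := repeat first
  [ assumption | exact: isO_cst | exact: isO0_id | apply: isOD | apply: isOB
  | apply: isON | apply: isO0M | apply: isO0X ].

Section Expansion.
Context {R : realType}.
Implicit Types (A B : R -> R).

Lemma isO_small k (f : R -> R) (e : R) : isO k.+1 f -> 0 < e ->
  \forall t \near (0 : R), `|f t| <= e.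
Proof.
move=> fk e0; have [K fK] := isO_le (ltn0Sn k) fk.
have e1 : 0 < e / (`|K| + 1) by rewrite divr_gt0// ltr_wpDl.
have smallt : \forall t \near (0 : R), `|t| <= e / (`|K| + 1).
  near=> t; near: t; move: e1; exact: (@cvgr0_norm_le _ _ _ _ _ id).
near=> t.
have ft : `|f t| <= K * `|t| ^+ 1 by near: t.
have te : `|t| <= e / (`|K| + 1) by near: t.
apply: le_trans ft _; apply: (@le_trans _ _ ((`|K| + 1) * `|t|)).
  by rewrite expr1 ler_wpM2r// (le_trans (ler_norm _))// lerDl.
by rewrite mulrC -ler_pdivlMr// ltr_wpDl.
Unshelve. all: by end_near. Qed.

(** The right-hand side collects, up to order [8], the terms of the exponential series
    of the polynomial; only its first four powers reach that order. *)
Lemma isO_expR A a1 a2 a3 a4 :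
  isO 9 (fun t => A t - (a1 * t ^+ 2 + a2 * t ^+ 4 + a3 * t ^+ 6 + a4 * t ^+ 8)) ->
  isO 9 (fun t => expR (A t) - (1 + a1 * t ^+ 2 + (a2 + a1 ^+ 2 / 2) * t ^+ 4
    + (a3 + a1 * a2 + a1 ^+ 3 / 6) * t ^+ 6
    + (a4 + a1 * a3 + a2 ^+ 2 / 2 + a1 ^+ 2 * a2 / 2 + a1 ^+ 4 / 24) * t ^+ 8)).
Proof.
move=> HA.
pose p t : R := a1 * t ^+ 2 + a2 * t ^+ 4 + a3 * t ^+ 6 + a4 * t ^+ 8.
pose a t : R := a1 + a2 * t ^+ 2 + a3 * t ^+ 4 + a4 * t ^+ 6.
pose E (x : R) : R := 1 + x + x ^+ 2 / 2 + x ^+ 3 / 6 + x ^+ 4 / 24.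
have a0 : isO 0 a by rewrite /a; isO0.
have p2 : isO 2 p.
  by apply: isO_ext (isOM (isO_Xn 2) a0) => t; rewrite /p /a; ring.
have A2 : isO 2 A.
  apply: (@isO_ext _ _ _ (fun t => (A t - p t) + p t)); first by move=> t; ring.
  by apply: isOD p2; apply: isO_le HA.
have A0 := isO_le (leq0n _) A2; have p0 := isO_le (leq0n _) p2.
(* the exponential series, truncated where its terms are of order t^10 *)
have HE : isO 9 (fun t => expR (A t) - E (A t)).
  apply: (@isO_le _ _ (2 + 2 + 2 + 2 + 2)) => //.
  apply: (@isO_bound _ _ _ (fun t => A t ^+ 5) (expR 1)).
    near=> t; rewrite normrX; apply: expR_remainder5.
    by near: t; exact: isO_small A2 ltr01.
  apply: isO_ext (isOM (isOM (isOM (isOM A2 A2) A2) A2) A2) => t.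
  by rewrite !exprS expr0; ring.
have HEp : isO 9 (fun t => E (A t) - E (p t)).
  apply: (@isO_ext _ _ _ (fun t => (A t - p t) * (1 + (A t + p t) * 2^-1
    + (A t ^+ 2 + A t * p t + p t ^+ 2) * 6^-1
    + (A t ^+ 3 + A t ^+ 2 * p t + A t * p t ^+ 2 + p t ^+ 3) * 24^-1))).
    by move=> t; rewrite /E; field.
  by rewrite -[9%N]addn0; apply: isOM HA _; isO0.
(* [p = s * a] with [s = t^2]; the [rk] are the tails of the powers of [a] *)
pose r2 t : R := (a1 * a4 + a2 * a3) * 2 + (a2 * a4 * 2 + a3 ^+ 2) * t ^+ 2
  + a3 * a4 * 2 * t ^+ 4 + a4 ^+ 2 * t ^+ 6.
pose r3 t : R := a1 * (a1 * a3 * 2 + a2 ^+ 2) + a2 * (a1 * a2 * 2)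
  + a3 * a1 ^+ 2 + (a2 * (a1 * a3 * 2 + a2 ^+ 2) + a3 * (a1 * a2 * 2) + a4 * a1 ^+ 2) * t ^+ 2
  + (a3 * (a1 * a3 * 2 + a2 ^+ 2) + a4 * (a1 * a2 * 2)) * t ^+ 4
  + a4 * (a1 * a3 * 2 + a2 ^+ 2) * t ^+ 6 + a t * r2 t * t ^+ 2.
pose r4 t : R := a1 * (a1 ^+ 2 * a2 * 3) + a2 * a1 ^+ 3
  + (a2 * (a1 ^+ 2 * a2 * 3) + a3 * a1 ^+ 3) * t ^+ 2
  + (a3 * (a1 ^+ 2 * a2 * 3) + a4 * a1 ^+ 3) * t ^+ 4
  + a4 * (a1 ^+ 2 * a2 * 3) * t ^+ 6 + a t * r3 t * t ^+ 2.
have r20 : isO 0 r2 by rewrite /r2; isO0.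
have r30 : isO 0 r3 by rewrite /r3; isO0.
have r40 : isO 0 r4 by rewrite /r4; isO0.
have Hp : isO 9 (fun t => E (p t) - (1 + a1 * t ^+ 2 + (a2 + a1 ^+ 2 / 2) * t ^+ 4
    + (a3 + a1 * a2 + a1 ^+ 3 / 6) * t ^+ 6
    + (a4 + a1 * a3 + a2 ^+ 2 / 2 + a1 ^+ 2 * a2 / 2 + a1 ^+ 4 / 24) * t ^+ 8)).
  apply: (@isO_le _ _ 10) => //.
  apply: (@isO_ext _ _ _ (fun t => t ^+ 10 * (r2 t * 2^-1 + r3 t * 6^-1 + r4 t * 24^-1))).
    by move=> t; rewrite /E /p /r4 /r3 /r2 /a; field.
  by apply: isO_XnM; isO0.
apply: isO_ext (isOD (isOD HE HEp) Hp) => t.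
by rewrite /E; ring.
Unshelve. all: by end_near. Qed.

Lemma isO_cos B b3 b5 : isO 6 (fun t => B t - (b3 * t ^+ 3 + b5 * t ^+ 5)) ->
  isO 9 (fun t => cos (B t) - (1 - b3 ^+ 2 / 2 * t ^+ 6 - b3 * b5 * t ^+ 8)).
Proof.
move=> HB; pose q t : R := b3 * t ^+ 3 + b5 * t ^+ 5.
have q3 : isO 3 q.
  apply: (@isO_ext _ _ _ (fun t => t ^+ 3 * (b3 + b5 * t ^+ 2))).
    by move=> t; rewrite /q; ring.
  by apply: isO_XnM; isO0.
have B3 : isO 3 B.
  apply: (@isO_ext _ _ _ (fun t => (B t - q t) + q t)); first by move=> t; ring.
  by apply: isOD q3; apply: isO_le HB.
have Hc : isO 9 (fun t => cos (B t) - (1 - B t ^+ 2 / 2)).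
  apply: (@isO_bound _ _ _ (fun t => B t ^+ 3) 1).
    by near=> t; rewrite mul1r normrX; exact: cos_remainder3.
  by apply: isO_ext (isOM (isOM B3 B3) B3) => t; rewrite !exprS expr0; ring.
have Hq : isO 9 (fun t => (B t - q t) * (B t + q t)).
  by apply: (@isOM _ 6 3) => //; exact: isOD.
have Hr : isO 9 (fun t => t ^+ 10 * (b5 ^+ 2)).
  by apply: (@isO_le _ _ 10) => //; apply: isO_XnM; isO0.
apply: isO_ext (isOB Hc (isOD (isOZ 2^-1 Hq) (isOZ 2^-1 Hr))) => t.
by rewrite /q; field.
Unshelve. all: by end_near. Qed.

(** Expansion to order [8] of the real part of [exp (A + iB)]. *)
Lemma isO_expR_cos A B a1 a2 a3 a4 b3 b5 :
  isO 9 (fun t => A t - (a1 * t ^+ 2 + a2 * t ^+ 4 + a3 * t ^+ 6 + a4 * t ^+ 8)) ->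
  isO 6 (fun t => B t - (b3 * t ^+ 3 + b5 * t ^+ 5)) ->
  isO 9 (fun t => expR (A t) * cos (B t) -
   (1 + a1 * t ^+ 2 + (a2 + a1 ^+ 2 / 2) * t ^+ 4
    + (a3 + a1 * a2 + a1 ^+ 3 / 6 - b3 ^+ 2 / 2) * t ^+ 6
    + (a4 + a1 * a3 + a2 ^+ 2 / 2 + a1 ^+ 2 * a2 / 2 + a1 ^+ 4 / 24
       - b3 * b5 - a1 * b3 ^+ 2 / 2) * t ^+ 8)).
Proof.
move=> /isO_expR HA /isO_cos HB.
set c1 := a1 in HA *; set c2 := a2 + _ in HA *; set c3 := a3 + _ + _ in HA *.
set c4 := a4 + _ + _ + _ + _ in HA *.
have cosB : isO 0 (fun t => cos (B t)).
  by exists 1; near=> t; rewrite expr0 mulr1 cos_max.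
pose u t : R := 1 + c1 * t ^+ 2 + c2 * t ^+ 4 + c3 * t ^+ 6 + c4 * t ^+ 8.
pose w : R := b3 ^+ 2 / 2.
have u0 : isO 0 u by rewrite /u; isO0.
have H1 := isOM HA cosB.
have H2 := isOM u0 HB.
pose r t : R := c2 * w + c1 * (b3 * b5) + (c3 * w + c2 * (b3 * b5)) * t ^+ 2
  + (c4 * w + c3 * (b3 * b5)) * t ^+ 4 + c4 * (b3 * b5) * t ^+ 6.
have H3 : isO 9 (fun t => t ^+ 10 * r t).
  apply: (@isO_le _ _ 10) => //; apply: isO_XnM.
  by rewrite /r; isO0.
rewrite addn0 in H1; rewrite add0n in H2.
apply: isO_ext (isOB (isOD H1 H2) H3) => t.
by rewrite /u /r /w; field.
Unshelve. all: by end_near. Qed.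

(** The imaginary part of [exp (A + iB)]; order [3] suffices for the third moment. *)
Lemma isO_expR_sin A B b3 : isO 2 A -> isO 5 (fun t => B t - b3 * t ^+ 3) ->
  isO 4 (fun t => expR (A t) * sin (B t) - b3 * t ^+ 3).
Proof.
move=> A2 HB.
have B3 : isO 3 B.
  apply: (@isO_ext _ _ _ (fun t => (B t - b3 * t ^+ 3) + b3 * t ^+ 3)).
    by move=> t; ring.
  by apply: isOD (isOZ _ (isO_Xn 3)); apply: isO_le HB.
have sB : isO 4 (fun t => sin (B t) - B t).
  apply: (@isO_le _ _ (3 + 3)) => //.
  apply: (@isO_bound _ _ _ (fun t => B t * B t) 1); last exact: isOM.
  by near=> t; rewrite -expr2 normrX mul1r; exact: sin_remainder2.
have eA : isO 2 (fun t => expR (A t) - 1).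
  apply: (@isO_bound _ _ _ A (expR 1)) => //; near=> t.
  have A1 : `|A t| <= 1 by near: t; exact: isO_small A2 ltr01.
  by have := expR_remainder 1 A1; rewrite big_ord_recl big_ord0 expr0 fact0 divr1 addr0 expr1.
have s0 : isO 3 (fun t => sin (B t)).
  apply: (@isO_ext _ _ _ (fun t => (sin (B t) - B t) + B t)); first by move=> t; ring.
  by apply: isOD B3; apply: isO_le sB.
have H1 : isO 4 (fun t => (expR (A t) - 1) * sin (B t)).
  by apply: (@isO_le _ _ (2 + 3)) => //; exact: isOM.
have H2 := isO_le (leqnSn 4) HB.
by apply: isO_ext (isOD (isOD H1 sB) H2) => t; ring.
Unshelve. all: by end_near. Qed.

End Expansion.

(** * Bounded substitutes of the moments *)

Section SineMoments.
Context {R : realType}.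
Implicit Types (P : probability R R) (m t x : R) (k : nat -> R).

(** The law of [m + Y] has a characteristic function whose logarithm [A + iB], after
    centring at [m], expands at the origin as if [Y] had mean [0] and cumulants [k].
    Order [6] suffices for [B], of order [3], which enters the even moments through
    its square. *)
Definition cumulants_upto8 P m k : Prop := exists A B : R -> R,
  [/\ forall t, \int[P]_x cos (t * (x - m)) = expR (A t) * cos (B t),
      forall t, \int[P]_x sin (t * (x - m)) = expR (A t) * sin (B t),
      isO 9 (fun t => A t - (- (k 2 / 2) * t ^+ 2 + k 4 / 24 * t ^+ 4
                - k 6 / 720 * t ^+ 6 + k 8 / (56 * 720) * t ^+ 8)) &
      isO 6 (fun t => B t - (- (k 3 / 6) * t ^+ 3 + k 5 / 120 * t ^+ 5))].

(** A bounded substitute of [(x - m) ^+ p], to which it converges as [t] tends to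
    [0]. *)
Definition sine_power m p t x : R := (sin (t * (x - m)) / t) ^+ p.

Lemma measurable_affine t m : measurable_fun setT (fun x => t * (x - m)).
Proof. by apply: measurable_funM => //; exact: measurable_funB. Qed.

Lemma bounded_measurable_cos t m : bounded_measurable (fun x => cos (t * (x - m))).
Proof.
split; last by exists 1 => x; exact: cos_max.
apply: (measurableT_comp (f := @cos R)); last exact: measurable_affine.
by apply: continuous_measurable_fun; exact: continuous_cos.
Qed.

Lemma bounded_measurable_sin t m : bounded_measurable (fun x => sin (t * (x - m))).
Proof.
split; last by exists 1 => x; exact: sin_max.
apply: (measurableT_comp (f := @sin R)); last exact: measurable_affine.
by apply: continuous_measurable_fun; exact: continuous_sin.
Qed.

Lemma bounded_measurable_cosM t : bounded_measurable (fun x : R => cos (t * x)).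
Proof. by have := bounded_measurable_cos t 0; under eq_fun do rewrite subr0. Qed.

Lemma bounded_measurable_sinM t : bounded_measurable (fun x : R => sin (t * x)).
Proof. by have := bounded_measurable_sin t 0; under eq_fun do rewrite subr0. Qed.

Lemma bounded_measurable_sine_power m p t :
  bounded_measurable (sine_power m p t).
Proof.
apply: bounded_measurableX; apply: bounded_measurableM; first exact: bounded_measurable_sin.
exact: bounded_measurable_cst.
Qed.

Lemma sine_power_sqr m p t x : sine_power m p t x ^+ 2 = sine_power m (p * 2) t x.
Proof. by rewrite /sine_power -exprM. Qed.

Lemma cos2x x : cos (2 * x) = 1 - 2 * sin x ^+ 2.
Proof. by rewrite mulr_natl cos_mulr2n cos2sin2; ring. Qed.

Lemma cos4x x : cos (4 * x) = 2 * cos (2 * x) ^+ 2 - 1.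
Proof. by rewrite (_ : 4 * x = (2 * x) *+ 2) ?cos_mulr2n; ring. Qed.

Lemma cos6x x : cos (6 * x) = 4 * cos (2 * x) ^+ 3 - 3 * cos (2 * x).
Proof.
rewrite (_ : 6 * x = (2 * x) *+ 2 + 2 * x); last by ring.
rewrite cosD cos_mulr2n sin_mulr2n; have := cos2Dsin2 (2 * x).
move: (cos _) (sin _) => c s /(canRL (addrK _)) cs.
have -> : (c * s) *+ 2 * s = 2 * c * (1 - c ^+ 2) by rewrite cs; ring.
by ring.
Qed.

Lemma cos8x x : cos (8 * x) = 2 * cos (4 * x) ^+ 2 - 1.
Proof. by rewrite (_ : 8 * x = (4 * x) *+ 2) ?cos_mulr2n; ring. Qed.

Lemma sin3x x : sin (3 * x) = 3 * sin x - 4 * sin x ^+ 3.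
Proof.
rewrite (_ : 3 * x = x *+ 2 + x); last by ring.
rewrite sinD sin_mulr2n cos_mulr2n; have := cos2Dsin2 x.
move: (cos _) (sin _) => c s /(canRL (addrK _)) cs.
have -> : (c * s) *+ 2 * c = 2 * s * c ^+ 2 by ring.
by rewrite cs; ring.
Qed.

Lemma sin_pow3 x : sin x ^+ 3 = 3 / 4 * sin x - 4^-1 * sin (3 * x).
Proof. by rewrite sin3x; field. Qed.

Lemma sin_pow4 x : sin x ^+ 4 = 3 / 8 - 2^-1 * cos (2 * x) + 8^-1 * cos (4 * x).
Proof. by rewrite cos4x cos2x; field. Qed.

Lemma sin_pow6 x : sin x ^+ 6 =
  10 / 32 - 15 / 32 * cos (2 * x) + 6 / 32 * cos (4 * x) - 32^-1 * cos (6 * x).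
Proof. by rewrite cos6x cos4x cos2x; field. Qed.

Lemma sin_pow8 x : sin x ^+ 8 =
  35 / 128 - 56 / 128 * cos (2 * x) + 28 / 128 * cos (4 * x)
  - 8 / 128 * cos (6 * x) + 128^-1 * cos (8 * x).
Proof. by rewrite cos8x cos6x cos4x cos2x; field. Qed.

Section Limits.
Variables (P : probability R R) (m : R) (k : nat -> R).
Hypothesis Pk : cumulants_upto8 P m k.

Let F t := \int[P]_x cos (t * (x - m)).
Let G t := \int[P]_x sin (t * (x - m)).

Let bcos := bounded_measurable_cos.
Let bsin := bounded_measurable_sin.

Let sine_powerE p t : \int[P]_x sine_power m p t x =
  (\int[P]_x sin (t * (x - m)) ^+ p) / t ^+ p.
Proof.
rewrite mulrC -prob_RintegralZ; last exact/bounded_measurableX/bsin.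
by apply: eq_Rintegral => x _; rewrite /sine_power expr_div_n mulrC.
Qed.

Let int3 t : \int[P]_x sin (t * (x - m)) ^+ 3 = 3 / 4 * G t - 4^-1 * G (3 * t).
Proof.
rewrite -!prob_RintegralZ -?prob_RintegralB; do ?exact: bounded_measurableZ; do ?exact: bsin.
by apply: eq_Rintegral => x _; rewrite sin_pow3 !mulrA.
Qed.

Ltac bounded_meas := repeat first
  [ exact: bounded_measurable_cst | exact: bounded_measurable_cos
  | exact: bounded_measurable_sin | apply: bounded_measurableZ
  | apply: bounded_measurableB | apply: bounded_measurableD ].

Let int4 t : \int[P]_x sin (t * (x - m)) ^+ 4 =
  3 / 8 - 2^-1 * F (2 * t) + 8^-1 * F (4 * t).
Proof.
transitivity (\int[P]_x (3 / 8 - 2^-1 * cos (2 * t * (x - m))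
    + 8^-1 * cos (4 * t * (x - m)))).
  by apply: eq_Rintegral => x _; rewrite sin_pow4 !mulrA.
rewrite prob_RintegralD; [|bounded_meas..].
rewrite prob_RintegralB; [|bounded_meas..].
rewrite prob_Rintegral_cst.
by rewrite !prob_RintegralZ; [|bounded_meas..].
Qed.

Let int6 t : \int[P]_x sin (t * (x - m)) ^+ 6 =
  10 / 32 - 15 / 32 * F (2 * t) + 6 / 32 * F (4 * t) - 32^-1 * F (6 * t).
Proof.
transitivity (\int[P]_x (10 / 32 - 15 / 32 * cos (2 * t * (x - m))
    + 6 / 32 * cos (4 * t * (x - m)) - 32^-1 * cos (6 * t * (x - m)))).
  by apply: eq_Rintegral => x _; rewrite sin_pow6 !(mulrA _ t).
rewrite prob_RintegralB; [|bounded_meas..].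
rewrite prob_RintegralD; [|bounded_meas..].
rewrite prob_RintegralB; [|bounded_meas..].
rewrite prob_Rintegral_cst.
by rewrite !prob_RintegralZ; [|bounded_meas..].
Qed.

Let int8 t : \int[P]_x sin (t * (x - m)) ^+ 8 =
  35 / 128 - 56 / 128 * F (2 * t) + 28 / 128 * F (4 * t)
  - 8 / 128 * F (6 * t) + 128^-1 * F (8 * t).
Proof.
transitivity (\int[P]_x (35 / 128 - 56 / 128 * cos (2 * t * (x - m))
    + 28 / 128 * cos (4 * t * (x - m)) - 8 / 128 * cos (6 * t * (x - m))
    + 128^-1 * cos (8 * t * (x - m)))).
  by apply: eq_Rintegral => x _; rewrite sin_pow8 !(mulrA _ t).
rewrite prob_RintegralD; [|bounded_meas..].
rewrite prob_RintegralB; [|bounded_meas..].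
rewrite prob_RintegralD; [|bounded_meas..].
rewrite prob_RintegralB; [|bounded_meas..].
rewrite prob_Rintegral_cst.
by rewrite !prob_RintegralZ; [|bounded_meas..].
Qed.

Let m4 := k 4 + 3 * k 2 ^+ 2.
Let m6 := k 6 + 15 * (k 4 * k 2) + 10 * k 3 ^+ 2 + 15 * k 2 ^+ 3.
Let m8 := k 8 + 28 * (k 6 * k 2) + 56 * (k 5 * k 3) + 35 * k 4 ^+ 2
  + 210 * (k 4 * k 2 ^+ 2) + 280 * (k 3 ^+ 2 * k 2) + 105 * k 2 ^+ 4.

(** The coefficients are the moments of a centred variable with cumulants [k]. *)
Let isO_F : isO 9 (fun t => F t - (1 - k 2 / 2 * t ^+ 2 + m4 / 24 * t ^+ 4
  - m6 / 720 * t ^+ 6 + m8 / (56 * 720) * t ^+ 8)).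
Proof.
have [A [B [FE GE HA HB]]] := Pk.
have HA' : isO 9 (fun t => A t - (- (k 2 / 2) * t ^+ 2 + k 4 / 24 * t ^+ 4
                + (- (k 6 / 720)) * t ^+ 6 + k 8 / (56 * 720) * t ^+ 8)).
  by apply: isO_ext HA => t; ring.
apply: isO_ext (isO_expR_cos HA' HB) => t.
by rewrite /F FE /m4 /m6 /m8; field.
Qed.

Let isO_G : isO 4 (fun t => G t - - (k 3 / 6) * t ^+ 3).
Proof.
have [A [B [FE GE HA HB]]] := Pk.
apply: (@isO_ext _ _ _ (fun t => expR (A t) * sin (B t) - - (k 3 / 6) * t ^+ 3)).
  by move=> t; rewrite /G GE.
apply: isO_expR_sin.
  pose a t := - (k 2 / 2) + k 4 / 24 * t ^+ 2 - k 6 / 720 * t ^+ 4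
    + k 8 / (56 * 720) * t ^+ 6.
  have a2 : isO 2 (fun t => t ^+ 2 * a t).
    by apply: isO_XnM; rewrite /a; isO0.
  apply: isO_ext (isOD (isO_le (isT : 2 <= 9)%N HA) a2) => t.
  by rewrite /a; ring.
apply: isO_ext (isOD (isO_le (isT : 5 <= 6)%N HB) (isOZ (k 5 / 120) (isO_Xn 5))) => t.
by ring.
Qed.

(** In each limit below the multiple-angle formula annihilates the monomials of lower
    degree, as a finite difference does. *)
Lemma sine_power3_cvg : \int[P]_x sine_power m 3 t x @[t --> 0^'] --> k 3.
Proof.
under eq_fun do rewrite sine_powerE; apply: isO_cvg.
apply: isO_ext (isOB (isOZ (3 / 4) isO_G) (isOZ 4^-1 (isO_scale 3 isO_G))) => t.
by rewrite int3; field.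
Qed.

Lemma sine_power4_cvg : \int[P]_x sine_power m 4 t x @[t --> 0^'] --> m4.
Proof.
under eq_fun do rewrite sine_powerE; apply: isO_cvg.
have F5 := isO_le (isT : 5 <= 9)%N isO_F.
(* the monomials of degree 6 and 8 of the expansion do not cancel, but are negligible *)
have X c d : isO 5 (fun t : R => t ^+ 6 * (c + d * t ^+ 2)).
  by apply: (@isO_le _ _ 6) => //; apply: isO_XnM; isO0.
apply: isO_ext (isOD (isOB (isOZ 8^-1 (isO_scale 4 F5)) (isOZ 2^-1 (isO_scale 2 F5)))
  (X (480 * (- (m6 / 720))) (8064 * (m8 / (56 * 720))))) => t.
by rewrite int4; field.
Qed.

Lemma sine_power6_cvg : \int[P]_x sine_power m 6 t x @[t --> 0^'] --> m6.
Proof.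
under eq_fun do rewrite sine_powerE; apply: isO_cvg.
have F7 := isO_le (isT : 7 <= 9)%N isO_F.
(* what is left of the monomial of degree 8 *)
have X : isO 7 (fun t : R => - m8 * t ^+ 8).
  by apply: (@isO_le _ _ 8) => //; apply: isOZ; exact: isO_Xn.
apply: isO_ext (isOD (isOB (isOB (isOZ (6 / 32) (isO_scale 4 F7))
  (isOZ (15 / 32) (isO_scale 2 F7))) (isOZ 32^-1 (isO_scale 6 F7))) X) => t.
by rewrite int6; field.
Qed.

Lemma sine_power8_cvg : \int[P]_x sine_power m 8 t x @[t --> 0^'] --> m8.
Proof.
under eq_fun do rewrite sine_powerE; apply: isO_cvg.
apply: isO_ext (isOD (isOB (isOB (isOZ (28 / 128) (isO_scale 4 isO_F))
  (isOZ (56 / 128) (isO_scale 2 isO_F))) (isOZ (8 / 128) (isO_scale 6 isO_F)))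
  (isOZ 128^-1 (isO_scale 8 isO_F))) => t.
by rewrite int8; field.
Qed.

End Limits.

(** The test based on [sine_power m p t] works for every [t], hence in the limit. *)
Lemma sine_power_tv_dist_ge (P Q : probability R R) m p l1 l2 s1 s2 n :
  (0 < n)%N ->
  \int[P]_x sine_power m p t x @[t --> 0^'] --> l1 ->
  \int[Q]_x sine_power m p t x @[t --> 0^'] --> l2 ->
  \int[P]_x sine_power m (p * 2) t x @[t --> 0^'] --> s1 ->
  \int[Q]_x sine_power m (p * 2) t x @[t --> 0^'] --> s2 ->
  l1 != l2 ->
  ((1 - 4 * (s1 + s2) / (n%:R * (l1 - l2) ^+ 2))%:E
    <= tv_dist (iid_law P n) (iid_law Q n))%E.
Proof.
move=> n0 cP cQ cP2 cQ2 l12.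
pose e t := 1 - 4 * (\int[P]_x sine_power m (p * 2) t x +
    \int[Q]_x sine_power m (p * 2) t x) /
   (n%:R * (\int[P]_x sine_power m p t x - \int[Q]_x sine_power m p t x) ^+ 2).
have gap : l1 - l2 != 0 by rewrite subr_eq0.
have cg : (\int[P]_x sine_power m p t x - \int[Q]_x sine_power m p t x)
    @[t --> 0^'] --> l1 - l2 by exact: cvgB.
have ce : e t @[t --> 0^'] --> 1 - 4 * (s1 + s2) / (n%:R * (l1 - l2) ^+ 2).
  apply: cvgB; first exact: cvg_cst.
  apply: cvgM; first by apply: cvgM; [exact: cvg_cst|exact: cvgD].
  apply: cvgV; first by rewrite mulf_neq0 ?expf_neq0// pnatr_eq0 -lt0n.
  by apply: cvgM; [exact: cvg_cst|exact: (cvgM cg cg)].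
set TV := tv_dist _ _.
have le_TV : \forall t \near (0 : R)^', ((e t)%:E <= TV)%E.
  near=> t.
  have pq : \int[P]_x sine_power m p t x - \int[Q]_x sine_power m p t x != 0.
    near: t; exact: (cvgr_neq0 _ cg gap).
  rewrite subr_eq0 in pq.
  have := tv_dist_iid_ge (bounded_measurable_sine_power m p t) n0 pq.
  have E (S : probability R R) :
      \int[S]_x sine_power m (p * 2) t x = \int[S]_x sine_power m p t x ^+ 2.
    by apply: eq_Rintegral => x _; rewrite sine_power_sqr.
  by rewrite /e !E.
rewrite leNgt; apply/negP => ltTV.
have [r TVr] : exists r, (TV <= r%:E)%E /\ r < 1 - 4 * (s1 + s2) / (n%:R * (l1 - l2) ^+ 2).
  case: TV ltTV {le_TV} => [r||]; rewrite ?lte_fin => ltr //.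
    by exists r.
  by exists (1 - 4 * (s1 + s2) / (n%:R * (l1 - l2) ^+ 2) - 1); rewrite leNye ltrBlDr ltrDl.
case: TVr => TVr rlt.
near (0 : R)^' => t.
have re : r < e t by near: t; exact: (cvgr_gt _ ce _ rlt).
have eTV : ((e t)%:E <= TV)%E by near: t.
by have := le_trans eTV TVr; rewrite lee_fin leNgt re.
Unshelve. all: by end_near. Qed.

End SineMoments.

(** * The characteristic function of the Gaussian law *)

Section GaussCharacteristic.
Context {R : realType}.
Implicit Types (m v t h x : R).
Local Notation mu := (@lebesgue_measure R).

(** The density is the Radon-Nikodym derivative of the law, up to a null set. *)
Lemma ge0_integral_gauss_law m v (f : R -> \bar R) : measurable_fun setT f ->
  (forall x, (0 <= f x)%E) ->
  (\int[gauss_law m v]_x f x =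
   \int[mu]_x (f x * (normal_pdf m (Num.sqrt v) x)%:E))%E.
Proof.
move=> mf f0; rewrite ge0_integral_distribution//=.
have dom := normal_prob_dominates m (Num.sqrt v).
rewrite -(Radon_Nikodym_SigmaFinite.change_of_variables dom)//=.
have mRN := Radon_Nikodym_SigmaFinite.f_integrable dom.
apply: ae_eq_integral => //.
- by apply: emeasurable_funM => //; exact: measurable_int mRN.
- by apply: emeasurable_funM => //; apply/measurable_EFinP; exact: measurable_normal_pdf.
- apply: ae_eqe_mul2l => /=.
  apply: integral_ae_eq => //=.
  + by apply/measurable_EFinP; exact: measurable_normal_pdf.
  + by move=> E _ mE; rewrite -Radon_Nikodym_SigmaFinite.f_integral.
Qed.

Lemma normal_pdf_sqrtE m v x : 0 < v ->
  normal_pdf m (Num.sqrt v) x = normal_peak (Num.sqrt v) * normal_fun m (Num.sqrt v) x.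
Proof. by move=> v0; rewrite normal_pdfE// gt_eqF// sqrtr_gt0. Qed.

Lemma normal_pdf_translate m v c x : 0 < v ->
  normal_pdf (m + c) (Num.sqrt v) (x + c) = normal_pdf m (Num.sqrt v) x.
Proof.
move=> v0; rewrite !normal_pdf_sqrtE// /normal_fun.
by rewrite (_ : x + c - (m + c) = x - m)//; ring.
Qed.

Lemma normal_pdf_tilt m v h x : 0 < v ->
  normal_pdf (m + h * v) (Num.sqrt v) x =
  expR (h * (x - m)) * expR (- (h ^+ 2 * v / 2)) * normal_pdf m (Num.sqrt v) x.
Proof.
move=> v0; rewrite !normal_pdf_sqrtE// mulrCA; congr (_ * _).
rewrite /normal_fun -!expRD sqr_sqrtr ?ltW//; congr expR.
by field; rewrite gt_eqF.
Qed.

Lemma gauss_law_translate m v c (f : R -> R) : 0 < v -> continuous f ->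
  (forall x, 0 <= f x) ->
  (\int[gauss_law (m + c) v]_x (f x)%:E = \int[gauss_law m v]_x (f (x + c))%:E)%E.
Proof.
move=> v0 cf f0; have s0 : Num.sqrt v != 0 by rewrite gt_eqF// sqrtr_gt0.
have mf : measurable_fun setT f by exact: continuous_measurable_fun.
have mfc : measurable_fun setT (fun x => f (x + c)).
  by apply: (measurableT_comp mf); exact: measurable_funD.
rewrite !ge0_integral_gauss_law//=; do 2 ?[exact/measurable_EFinP|by move=> x; rewrite lee_fin].
pose G x := f x * normal_pdf (m + c) (Num.sqrt v) x.
pose F x := x + c.
have dF x : is_derive x 1 F 1.
  by rewrite -[X in is_derive _ _ _ X]addr0; apply: is_deriveD.
have F' : (F^`())%classic = cst 1.
  by apply/funext => x; rewrite derive1E; have [_ ->] := dF x.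
transitivity (\int[mu]_x (G x)%:E)%E; first by [].
rewrite (@increasing_ge0_integration_by_substitutionT R F G)//.
- apply: eq_integral => x _; rewrite F' !fctE /cst mulr1 /G /F -EFinM.
  by rewrite normal_pdf_translate.
- by move=> x y xy; rewrite /F ltrD2r.
- by rewrite F' => ?; exact: cvg_cst.
- by rewrite F'; exact: is_cvg_cst.
- by rewrite F'; exact: is_cvg_cst.
- exact: cvg_addrr_Ny.
- exact: cvg_addrr.
- move=> x; apply: cvgM; first exact: cf.
  exact: continuous_normal_pdf.
- by move=> x; rewrite mulr_ge0// normal_pdf_ge0.
Qed.

Lemma gauss_law_tilt m v h (f : R -> R) : 0 < v -> measurable_fun setT f ->
  (forall x, 0 <= f x) ->
  (\int[gauss_law (m + h * v) v]_x (f x)%:E =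
   (expR (- (h ^+ 2 * v / 2)))%:E * \int[gauss_law m v]_x (f x * expR (h * (x - m)))%:E)%E.
Proof.
move=> v0 mf f0.
have mexp : measurable_fun setT (fun x => expR (h * (x - m))).
  by apply: measurableT_comp => //; exact: measurable_affine.
rewrite !ge0_integral_gauss_law//=.
- rewrite -ge0_integralZl//=.
  + apply: eq_integral => x _; rewrite normal_pdf_tilt// -!EFinM; congr EFin.
    by ring.
  + apply/measurable_EFinP; apply: measurable_funM; first exact: measurable_funM.
    exact: measurable_normal_pdf.
  + by move=> x _; rewrite lee_fin !mulr_ge0 ?expR_ge0// normal_pdf_ge0.
- by apply/measurable_EFinP; exact: measurable_funM.
- by move=> x; rewrite lee_fin mulr_ge0 ?expR_ge0.
- exact/measurable_EFinP.
Qed.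

(** Comparing the two ways to move the mean, by translation and by tilting the
    density, gives the exponential moments of a Gaussian variable against any
    function. *)
Lemma gauss_law_exp m v h (f : R -> R) : 0 < v -> continuous f ->
  (forall x, 0 <= f x) ->
  (\int[gauss_law m v]_x (f x * expR (h * (x - m)))%:E =
   (expR (h ^+ 2 * v / 2))%:E * \int[gauss_law m v]_x (f (x + h * v))%:E)%E.
Proof.
move=> v0 cf f0; have mf : measurable_fun setT f by exact: continuous_measurable_fun.
rewrite -gauss_law_translate// gauss_law_tilt// muleA -EFinM -expRD addrN expR0.
by rewrite mul1e.
Qed.

Section Fixed.
Variables (m v : R).
Hypothesis v0 : 0 < v.
Let P := gauss_law m v.
Let y (x : R) := x - m.

Let expy h : (\int[P]_x (expR (h * y x))%:E = (expR (h ^+ 2 * v / 2))%:E)%E.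
Proof.
have c1 : continuous (fun _ : R => 1 : R) by move=> ?; exact: cvg_cst.
have := @gauss_law_exp m v h (fun=> 1) v0 c1 (fun=> ler01).
rewrite integral_cst//= probability_setT !mule1 => <-.
by apply: eq_integral => x _; rewrite mul1r.
Qed.

Let mexp h : measurable_fun setT (fun x => expR (h * y x)).
Proof. by apply: measurableT_comp => //; exact: measurable_affine. Qed.

Let iexp h : P.-integrable setT (EFin \o (fun x => expR (h * y x))).
Proof.
apply/integrableP; split; first exact/measurable_EFinP.
under eq_integral do rewrite /= ger0_norm ?expR_ge0//.
by rewrite expy ltry.
Qed.

(* every integrand below is dominated by [D], whose integrability is that of the
   exponential moments *)
Let D x := expR (2 * y x) + expR (-2 * y x).

Let D_ge0 x : 0 <= D x. Proof. by rewrite addr_ge0// expR_ge0. Qed.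

Let iD : P.-integrable setT (EFin \o D).
Proof.
rewrite (_ : EFin \o D = (fun x => (EFin \o (fun x => expR (2 * y x))) x
   + (EFin \o (fun x => expR (-2 * y x))) x)%E); last by apply/funext.
by apply: integrableD.
Qed.

Let D_bound h x : `|h| <= 1 -> (1 + `|y x|) * expR (h * y x) <= D x.
Proof.
move=> h1.
have key (u : R) : 0 <= u -> (1 + u) * expR u <= expR (2 * u).
  by move=> u0; rewrite mulr_natl mulr2n expRD ler_wpM2r ?expR_ge0// expR_ge1Dx.
apply: (@le_trans _ _ ((1 + `|y x|) * expR `|y x|)).
  rewrite ler_wpM2l ?addr_ge0// ler_expR (le_trans (ler_norm _))// normrM.
  by rewrite ler_piMl.
apply: le_trans (key _ (normr_ge0 _)) _.
rewrite /D; have [y0|y0] := leP 0 (y x).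
  by rewrite ger0_norm// lerDl expR_ge0.
by rewrite ltr0_norm// mulrN mulNr lerDr expR_ge0.
Qed.

Let idom (f : R -> R) : measurable_fun setT f -> (forall x, `|f x| <= D x) ->
  P.-integrable setT (EFin \o f).
Proof.
move=> mf fD; apply: le_integrable iD => //; first exact/measurable_EFinP.
by move=> x _ /=; rewrite lee_fin (ger0_norm (D_ge0 x)).
Qed.

Let derive_integral (f df : R -> R -> R) (a : R) :
  (forall t x, is_derive t 1 (f^~ x) (df t x)) ->
  (forall t, P.-integrable setT (EFin \o f t)) ->
  (forall t x, `|t - a| <= 1 -> `|df t x| <= D x) ->
  is_derive a 1 (fun t => \int[P]_x f t x) (\int[P]_x df a x).
Proof.
move=> dfE fi dfD.
have d1E t x : partial1of2 f t x = df t x.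
  by rewrite partial1of2E; have [_ ->] := dfE t x.
have aI : `]a - 1, a + 1[%classic a.
  by rewrite /= in_itv/=; apply/andP; split; lra.
have H1 t x : `]a - 1, a + 1[%classic t -> setT x -> derivable (f^~ x) t 1.
  by move=> _ _; have [] := dfE t x.
have H2 t x : `]a - 1, a + 1[%classic t -> setT x -> `|partial1of2 f t x| <= D x.
  rewrite /= in_itv/= => /andP[ta at_] _; rewrite d1E; apply: dfD.
  by rewrite ler_norml; apply/andP; split; lra.
have fi' t : `]a - 1, a + 1[%classic t -> P.-integrable setT (EFin \o f t) by [].
apply: DeriveDef.
  exact: (derivable_under_integral measurableT aI fi' H1 D_ge0 iD H2).
rewrite -derive1E (differentiation_under_integral measurableT aI fi' H1 D_ge0 iD H2).
by apply: eq_Rintegral => x _; rewrite d1E.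
Qed.

Let phi t := \int[P]_x cos (t * y x).
Let sig t := \int[P]_x sin (t * y x).

Let cy t : continuous (fun x : R => t * y x).
Proof.
by move=> x; apply: cvgM; [exact: cvg_cst|apply: cvgB; [exact: cvg_id|exact: cvg_cst]].
Qed.

Let ccos t : continuous (fun x : R => cos (t * y x)).
Proof.
move=> x; apply: (@continuous_comp _ _ _ (fun x => t * y x) (@cos R)); first exact: cy.
exact: continuous_cos.
Qed.

Let csin t : continuous (fun x : R => sin (t * y x)).
Proof.
move=> x; apply: (@continuous_comp _ _ _ (fun x => t * y x) (@sin R)); first exact: cy.
exact: continuous_sin.
Qed.

Let bounded_exp (f : R -> R) h : measurable_fun setT f -> (forall x, `|f x| <= 1) ->
  P.-integrable setT (EFin \o (fun x => f x * expR (h * y x))).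
Proof.
move=> mf f1; apply: le_integrable (iexp h) => //.
  by apply/measurable_EFinP; exact: measurable_funM.
move=> x _ /=; rewrite lee_fin normrM (ger0_norm (expR_ge0 _)).
by rewrite ler_piMl// expR_ge0.
Qed.

Let int_exp (f : R -> R) h : continuous f -> (forall x, `|f x| <= 1) ->
  \int[P]_x (f x * expR (h * y x)) =
  expR (h ^+ 2 * v / 2) * \int[P]_x f (x + h * v).
Proof.
move=> cf f1; have mf : measurable_fun setT f by exact: continuous_measurable_fun.
have c1f : continuous (fun x => 1 + f x).
  by move=> x; apply: cvgD; [exact: cvg_cst|exact: cf].
have f0 x : 0 <= 1 + f x by have := f1 x; rewrite ler_norml => /andP[]; lra.
have bf : bounded_measurable (fun x => f (x + h * v)).
  split; last by exists 1.
  by apply: (measurableT_comp mf); exact: measurable_funD.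
have := @gauss_law_exp m v h (fun x => 1 + f x) v0 c1f f0.
rewrite -EFin_prob_Rintegral; last first.
  by apply: bounded_measurableD => //; exact: bounded_measurable_cst.
rewrite prob_RintegralD//; last exact: bounded_measurable_cst.
rewrite prob_Rintegral_cst -EFinM => /(congr1 fine)/= H.
have : \int[P]_x ((1 + f x) * expR (h * y x)) =
    expR (h ^+ 2 * v / 2) * (1 + \int[P]_x f (x + h * v)) by [].
have -> : \int[P]_x ((1 + f x) * expR (h * y x)) =
    \int[P]_x (expR (h * y x) + f x * expR (h * y x)).
  by apply: eq_Rintegral => x _; rewrite mulrDl mul1r.
rewrite RintegralD//; last exact: bounded_exp.
have -> : \int[P]_x expR (h * y x) = expR (h ^+ 2 * v / 2) by rewrite /Rintegral expy.
by rewrite mulrDr mulr1 => /addrI.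
Qed.

Let shift_arg t h x : t * y (x + h * v) = t * y x + h * (t * v).
Proof. by rewrite /y; ring. Qed.

Let bcos t : bounded_measurable (fun x => cos (t * y x)).
Proof. exact: bounded_measurable_cos. Qed.

Let bsin t : bounded_measurable (fun x => sin (t * y x)).
Proof. exact: bounded_measurable_sin. Qed.

Let int_cos_exp t h : \int[P]_x (cos (t * y x) * expR (h * y x)) =
  expR (h ^+ 2 * v / 2) * (cos (h * (t * v)) * phi t - sin (h * (t * v)) * sig t).
Proof.
rewrite (int_exp h (@ccos t) (fun x => cos_max _)); congr (_ * _).
rewrite -!prob_RintegralZ// -prob_RintegralB//; [|exact: bounded_measurableZ..].
by apply: eq_Rintegral => x _; rewrite shift_arg cosD mulrC [X in _ - X]mulrC.
Qed.

Let int_sin_exp t h : \int[P]_x (sin (t * y x) * expR (h * y x)) =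
  expR (h ^+ 2 * v / 2) * (cos (h * (t * v)) * sig t + sin (h * (t * v)) * phi t).
Proof.
rewrite (int_exp h (@csin t) (fun x => sin_max _)); congr (_ * _).
rewrite -!prob_RintegralZ// -prob_RintegralD//; [|exact: bounded_measurableZ..].
by apply: eq_Rintegral => x _; rewrite shift_arg sinD mulrC [X in _ + X]mulrC.
Qed.

Let mulyD (c h x : R) : `|h| <= 1 -> `|c| <= 1 -> `|c * (y x * expR (h * y x))| <= D x.
Proof.
move=> h1 c1; apply: le_trans (D_bound x h1).
rewrite !normrM (ger0_norm (expR_ge0 _)) mulrA ler_wpM2r ?expR_ge0//.
apply: (@le_trans _ _ (1 * `|y x|)); first by rewrite ler_wpM2r.
by rewrite mul1r lerDr.
Qed.

Let is_derive_exp (c x h : R) :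
  is_derive h 1 (fun h => c * expR (h * y x)) (c * (y x * expR (h * y x))).
Proof. by apply: is_derive_eq; rewrite /GRing.scale/=; ring. Qed.

(** Differentiating the exponential moments at [h = 0] expresses [sig'] and [- phi']
    through [sig] and [phi]: this is an instance of Stein's identity. *)
Let int_cos_y t : \int[P]_x (cos (t * y x) * y x) = - (t * v * sig t).
Proof.
have d1 : is_derive (0 : R) 1 (fun h => \int[P]_x (cos (t * y x) * expR (h * y x)))
    (\int[P]_x (cos (t * y x) * (y x * expR (0 * y x)))).
  apply: (derive_integral (df := fun h x => cos (t * y x) * (y x * expR (h * y x)))).
  - by move=> h x; exact: is_derive_exp.
  - by move=> h; apply: bounded_exp => [|x]; [case: (bcos t)|exact: cos_max].
  - by move=> h x; rewrite subr0 => h1; apply: mulyD => //; exact: cos_max.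
have d2 : is_derive (0 : R) 1 (fun h => expR (h ^+ 2 * v / 2) *
    (cos (h * (t * v)) * phi t - sin (h * (t * v)) * sig t)) (- (t * v * sig t)).
  apply: is_derive_eq; rewrite /GRing.scale/= expr0n/= !mul0r expR0 cos0 sin0.
  by ring.
transitivity (\int[P]_x (cos (t * y x) * (y x * expR (0 * y x)))).
  by apply: eq_Rintegral => x _; rewrite mul0r expR0 mulr1.
rewrite (funext (int_cos_exp t)) in d1.
by case: d1 => _ <-; case: d2 => _ <-.
Qed.

Let int_sin_y t : \int[P]_x (sin (t * y x) * y x) = t * v * phi t.
Proof.
have d1 : is_derive (0 : R) 1 (fun h => \int[P]_x (sin (t * y x) * expR (h * y x)))
    (\int[P]_x (sin (t * y x) * (y x * expR (0 * y x)))).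
  apply: (derive_integral (df := fun h x => sin (t * y x) * (y x * expR (h * y x)))).
  - by move=> h x; exact: is_derive_exp.
  - by move=> h; apply: bounded_exp => [|x]; [case: (bsin t)|exact: sin_max].
  - by move=> h x; rewrite subr0 => h1; apply: mulyD => //; exact: sin_max.
have d2 : is_derive (0 : R) 1 (fun h => expR (h ^+ 2 * v / 2) *
    (cos (h * (t * v)) * sig t + sin (h * (t * v)) * phi t)) (t * v * phi t).
  apply: is_derive_eq; rewrite /GRing.scale/= expr0n/= !mul0r expR0 cos0 sin0.
  by ring.
transitivity (\int[P]_x (sin (t * y x) * (y x * expR (0 * y x)))).
  by apply: eq_Rintegral => x _; rewrite mul0r expR0 mulr1.
rewrite (funext (int_sin_exp t)) in d1.
by case: d1 => _ <-; case: d2 => _ <-.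
Qed.

Let bound_y x c : `|c| <= 1 -> `|c * y x| <= D x.
Proof.
have := @mulyD c 0 x; rewrite normr0 ler01 mul0r expR0 mulr1.
by move=> H c1; exact: H.
Qed.

Let is_derive_phi t : is_derive t 1 phi (- (t * v * phi t)).
Proof.
have -> : - (t * v * phi t) = \int[P]_x (- sin (t * y x) * y x).
  rewrite -int_sin_y -mulN1r -RintegralZl//.
    by apply: eq_Rintegral => x _; rewrite mulN1r mulNr.
  apply: idom => [|x]; last by apply: bound_y => //; exact: sin_max.
  by apply: measurable_funM; [case: (bsin t)|exact: measurable_funB].
apply: (derive_integral (f := fun t x => cos (t * y x))
   (df := fun t x => - sin (t * y x) * y x)) => [s x|s|s x _].
- by apply: is_derive_eq; rewrite /GRing.scale/=; ring.
- exact: bounded_measurable_integrable.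
- by apply: bound_y => //; rewrite normrN; exact: sin_max.
Qed.

Let is_derive_sig t : is_derive t 1 sig (- (t * v * sig t)).
Proof.
rewrite -int_cos_y.
apply: (derive_integral (f := fun t x => sin (t * y x))
   (df := fun t x => cos (t * y x) * y x)) => [s x|s|s x _].
- by apply: is_derive_eq; rewrite /GRing.scale/=; ring.
- exact: bounded_measurable_integrable.
- by apply: bound_y => //; exact: cos_max.
Qed.

(* the quotient of [f] by the Gaussian solution has derivative [0] *)
Let ode_solution (f : R -> R) : (forall t, is_derive t 1 f (- (t * v * f t))) ->
  forall t, f t = expR (- (t ^+ 2 * v / 2)) * f 0.
Proof.
move=> df t; pose g s := expR (s ^+ 2 * v / 2) * f s.
have dg (s : R) : is_derive s 1 g 0.
  by apply: is_derive_eq; rewrite /GRing.scale/=; field.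
have := is_derive_0_is_cst t 0 dg; rewrite /g expr0n/= !mul0r expR0 mul1r => <-.
by rewrite mulrA -expRD addNr expR0 mul1r.
Qed.

Lemma gauss_law_cos t : \int[gauss_law m v]_x cos (t * (x - m)) = expR (- (t ^+ 2 * v / 2)).
Proof.
have := ode_solution is_derive_phi t; rewrite /phi => ->.
rewrite (_ : \int[P]_x _ = 1) ?mulr1//.
by under eq_Rintegral do rewrite mul0r cos0; exact: prob_Rintegral_cst.
Qed.

Lemma gauss_law_sin t : \int[gauss_law m v]_x sin (t * (x - m)) = 0.
Proof.
have := ode_solution is_derive_sig t; rewrite /sig => ->.
rewrite (_ : \int[P]_x _ = 0) ?mulr0//.
by under eq_Rintegral do rewrite mul0r sin0; exact: prob_Rintegral_cst.
Qed.

End Fixed.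

Lemma gauss_law_cumulants m v : 0 < v ->
  cumulants_upto8 (gauss_law m v) m (fun j => if j == 2 then v else 0).
Proof.
move=> v0; exists (fun t => - (t ^+ 2 * v / 2)), (fun=> 0).
split=> [t|t||] /=.
- by rewrite gauss_law_cos// cos0 mulr1.
- by rewrite gauss_law_sin// sin0 mulr0.
- by apply: isO_ext (isOZ 0 (isO_Xn 9)) => t; field.
- by apply: isO_ext (isOZ 0 (isO_Xn 6)) => t; field.
Qed.

End GaussCharacteristic.

(** * From time one to any time *)

Section Independence.
Context d (T : measurableType d) (R : realType) (P : probability T R).
Implicit Types (U V : {RV P >-> R}) (f g : R -> R).

Definition rv_pair U V (w : T) : R * R := (U w, V w).

HB.instance Definition _ U V := isMeasurableFun.Build _ _ _ _ (rv_pair U V)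
  (measurable_fun_pair (@measurable_funPT _ _ _ _ U) (@measurable_funPT _ _ _ _ V)).

Lemma eq_law_Rintegral U V f :
  (forall B, measurable B -> P [set w | B (U w)] = P [set w | B (V w)]) ->
  bounded_measurable f -> \int[P]_w f (U w) = \int[P]_w f (V w).
Proof.
move=> UV bf; rewrite -(Rintegral_distribution U bf) -(Rintegral_distribution V bf).
by congr fine; apply: eq_measure_integral => B mB _; exact: UV.
Qed.

Lemma independent_Rintegral U V f g :
  (forall A B, measurable A -> measurable B ->
    P ([set w | A (U w)] `&` [set w | B (V w)]) =
    (P [set w | A (U w)] * P [set w | B (V w)])%E) ->
  bounded_measurable f -> bounded_measurable g ->
  \int[P]_w (f (U w) * g (V w)) = (\int[P]_w f (U w)) * (\int[P]_w g (V w)).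
Proof.
move=> ind bf bg.
have bfg : bounded_measurable (fun z : R * R => f z.1 * g z.2).
  apply: bounded_measurableM.
    by apply: bounded_measurable_comp => //; exact: measurable_fst.
  by apply: bounded_measurable_comp => //; exact: measurable_snd.
transitivity (\int[distribution P (rv_pair U V)]_z (f z.1 * g z.2)).
  by rewrite Rintegral_distribution.
transitivity (\int[(distribution P U \x distribution P V)%E]_z (f z.1 * g z.2)).
  congr fine; apply: eq_measure_integral => B mB _.
  by apply/esym; apply: product_measure_unique => // A C mA mC; exact: ind.
rewrite Rintegral_prod//= -(Rintegral_distribution U bf) -(Rintegral_distribution V bg).
rewrite -[RHS]mulrC -prob_RintegralZ//; apply: eq_Rintegral => x _.
by rewrite prob_RintegralZ// mulrC.
Qed.

End Independence.

Section RealSemigroup.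
Context {R : realType}.
Implicit Types (c s : R -> R -> R) (A B : R -> R) (h u x : R).

Section Fixed.
Variables (c s : R -> R -> R) (A B : R -> R).
Hypothesis cD : forall g h u, 0 <= g -> 0 <= h ->
  c (g + h) u = c g u * c h u - s g u * s h u.
Hypothesis sD : forall g h u, 0 <= g -> 0 <= h ->
  s (g + h) u = s g u * c h u + c g u * s h u.
Hypothesis c_cont : forall h, 0 <= h -> continuous (c h).
Hypothesis s_cont : forall h, 0 <= h -> continuous (s h).
Hypothesis A_cont : continuous A.
Hypothesis B_cont : continuous B.
Hypothesis A0 : A 0 = 0.
Hypothesis B0 : B 0 = 0.
Hypothesis c0 : forall h, c h 0 = 1.
Hypothesis s0 : forall h, s h 0 = 0.
Hypothesis c1 : forall u, c 1 u = expR (A u) * cos (B u).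
Hypothesis s1 : forall u, s 1 u = expR (A u) * sin (B u).
Hypothesis c_time : forall h u, 0 <= h ->
  c g u @[g --> within [set g | 0 <= g] (nbhs h)] --> c h u.
Hypothesis s_time : forall h u, 0 <= h ->
  s g u @[g --> within [set g | 0 <= g] (nbhs h)] --> s h u.

Let good h := forall u, c h u = expR (h * A u) * cos (h * B u) /\
                        s h u = expR (h * A u) * sin (h * B u).

Let good1 : good 1.
Proof. by move=> u; rewrite !mul1r c1 s1. Qed.

Let goodD g h : 0 <= g -> 0 <= h -> good g -> good h -> good (g + h).
Proof.
move=> g0 h0 gg gh u; have [cg sg] := gg u; have [ch sh] := gh u.
rewrite cD// sD// cg sg ch sh !mulrDl expRD cosD sinD.
by split; ring.
Qed.

Let goodM h n : 0 <= h -> good h -> good (n.+1%:R * h).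
Proof.
move=> h0 gh; elim: n => [|n IH]; first by rewrite mul1r.
by rewrite -natr1 mulrDl mul1r; apply: goodD => //; rewrite mulr_ge0.
Qed.

(* the quotient of [c + i s] by the candidate [exp (h (A + iB))] *)
Let rho h u := expR (- (h * A u)) * (c h u * cos (h * B u) + s h u * sin (h * B u)).
Let tau h u := expR (- (h * A u)) * (s h u * cos (h * B u) - c h u * sin (h * B u)).

Let rho_cont h : 0 <= h -> continuous (rho h).
Proof.
move=> h0 u; have chB : {for u, continuous (fun u => h * B u)}.
  by apply: cvgM; [exact: cvg_cst|exact: B_cont].
apply: cvgM.
  apply: (@continuous_comp _ _ _ (fun u => - (h * A u)) (@expR R)); last exact: continuous_expR.
  by apply: cvgN; apply: cvgM; [exact: cvg_cst|exact: A_cont].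
apply: cvgD; apply: cvgM; [exact: c_cont| |exact: s_cont|].
- exact: (@continuous_comp _ _ _ (fun u => h * B u) (@cos R) _ chB (@continuous_cos R _)).
- exact: (@continuous_comp _ _ _ (fun u => h * B u) (@sin R) _ chB (@continuous_sin R _)).
Qed.

Let good_rho_tau h u : rho h u = 1 -> tau h u = 0 ->
  c h u = expR (h * A u) * cos (h * B u) /\ s h u = expR (h * A u) * sin (h * B u).
Proof.
move=> r1 t0; have := cos2Dsin2 (h * B u).
have e0 : expR (h * A u) * expR (- (h * A u)) = 1 by rewrite -expRD subrr expR0.
move: r1 t0 e0; rewrite /rho /tau.
set e := expR (h * A u); set e' := expR (- _); set C := cos _; set S := sin _.
set x := c h u; set y := s h u => r1 t0 e0 CS.
have xE : x = e * (e' * (x * C + y * S)) * C - e * (e' * (y * C - x * S)) * S.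
  rewrite !(mulrA e) e0 !mul1r -[LHS]mulr1 -CS; ring.
have yE : y = e * (e' * (x * C + y * S)) * S + e * (e' * (y * C - x * S)) * C.
  rewrite !(mulrA e) e0 !mul1r -[LHS]mulr1 -CS; ring.
by split; [rewrite [LHS]xE|rewrite [LHS]yE]; rewrite r1 t0; ring.
Qed.

Let rho_tau_double h u : 0 <= h -> rho (h + h) u = rho h u ^+ 2 - tau h u ^+ 2 /\
  tau (h + h) u = 2 * (rho h u * tau h u).
Proof.
move=> h0; rewrite /rho /tau cD// sD// !mulrDl opprD expRD cosD sinD.
by split; ring.
Qed.

Let good_rho h u : good h -> rho h u = 1 /\ tau h u = 0.
Proof.
move=> gh; have [cE sE] := gh u; rewrite /rho /tau cE sE.
have := cos2Dsin2 (h * B u).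
have : expR (- (h * A u)) * expR (h * A u) = 1 by rewrite -expRD addNr expR0.
set e := expR (- _); set e' := expR _; set C := cos _; set S := sin _ => ee CS.
split.
  have -> : e * (e' * C * C + e' * S * S) = (e * e') * (C ^+ 2 + S ^+ 2) by ring.
  by rewrite ee CS mulr1.
by ring.
Qed.

(* [rho] is continuous, of square [1], and equal to [1] at the origin *)
Let good_half h : 0 <= h -> good (h + h) -> good h.
Proof.
move=> h0 g2.
have sq u : tau h u = 0 /\ rho h u ^+ 2 = 1.
  have [r2 t2] := rho_tau_double u h0; have [r1 t0] := good_rho u g2.
  move: r2 t2; rewrite r1 t0 => /esym r2 /esym/eqP.
  rewrite mulf_eq0 pnatr_eq0/= mulf_eq0 => /orP[|] /eqP z; last first.
    by move: r2; rewrite z expr0n/= subr0.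
  move: r2; rewrite z expr0n/= sub0r => r2.
  by have := sqr_ge0 (tau h u); lra.
have rho_neq0 u : rho h u != 0.
  by apply/negP => /eqP z; have [_] := sq u; rewrite z expr0n/= => /eqP; rewrite eq_sym oner_eq0.
have rho0 : rho h 0 = 1.
  by rewrite /rho A0 B0 !mulr0 oppr0 expR0 cos0 sin0 c0 s0; ring.
have rho_gt0 u : 0 < rho h u.
  rewrite lt_neqAle eq_sym rho_neq0/= leNgt; apply/negP => rneg.
  have cu : continuous (fun w : R => w * u).
    by move=> w; apply: cvgM; [exact: cvg_id|exact: cvg_cst].
  have cf : {within `[0, 1], continuous (fun w : R => rho h (w * u))}.
    apply: continuous_subspaceT => w.
    exact: (@continuous_comp _ _ _ (fun w : R => w * u) (rho h) w (cu w) (@rho_cont h h0 (w * u))).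
  have [w _ fw] : exists2 w, w \in `[0, 1] & rho h (w * u) = 0.
    apply: IVT => //; rewrite mul0r mul1r rho0 ge_min le_max ler01 (ltW rneg).
    by rewrite orbT.
  by have := rho_neq0 (w * u); rewrite fw eqxx.
move=> u; apply: good_rho_tau; last by have [] := sq u.
have [_ /eqP] := sq u; rewrite sqrf_eq1 => /orP[/eqP //|/eqP r].
by have := rho_gt0 u; rewrite r; lra.
Qed.

Let good_dyadic k : good (2 ^- k).
Proof.
elim: k => [|k IH]; first by rewrite expr0 invr1.
apply: good_half; first by rewrite invr_ge0 exprn_ge0.
rewrite (_ : _ + _ = 2 ^- k)//.
have k0 : (2 : R) ^+ k != 0 by rewrite expf_neq0.
by rewrite exprS; field.
Qed.

(** The family [c h u + i s h u], multiplicative in the time [h], is determined by its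
    value at time [1]. At time [2^-k] it is a square root, equal to [1] at [u = 0], of
    its value at time [2^-(k-1)], and there is only one such root which is continuous
    in [u]; multiplicativity carries the identity to dyadic times and continuity in
    time to all times. *)
Lemma semigroup_exponent h u : 0 < h ->
  c h u = expR (h * A u) * cos (h * B u) /\ s h u = expR (h * A u) * sin (h * B u).
Proof.
move=> h0; pose q k : R := (Num.trunc (h * 2 ^+ k)).+1%:R * 2 ^- k.
have q0 k : 0 <= q k by rewrite mulr_ge0 ?invr_ge0 ?exprn_ge0.
have gq k : good (q k) by apply: goodM; [rewrite invr_ge0 exprn_ge0|exact: good_dyadic].
have two_gt0 k : (0 : R) < 2 ^+ k by rewrite exprn_gt0.
have qh : q k @[k --> \oo] --> h.
  apply: (@squeeze_cvgr _ _ _ _ (cst h) (fun k => h + 2 ^- k)).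
  - near=> k; have /andP[t1 t2] := truncn_itv (ltW (mulr_gt0 h0 (two_gt0 k))).
    apply/andP; split; first by rewrite /q ler_pdivlMr// ltW.
    by rewrite /q -natr1 mulrDl mul1r lerD2r ler_pdivrMr.
  - exact: cvg_cst.
  - rewrite -[X in _ --> X]addr0; apply: cvgD; first exact: cvg_cst.
    rewrite (_ : (fun k => 2 ^- k) = geometric 1 2^-1).
      by apply: cvg_geometric; rewrite ger0_norm ?invr_ge0// invf_lt1// ltr1n.
    by apply/funext => k; rewrite /geometric/= mul1r exprVn.
have within_q (f : R -> R) (l : R) : f g @[g --> within [set g | 0 <= g] (nbhs h)] --> l ->
    f (q k) @[k --> \oo] --> l.
  move=> fl U /fl wU.
  have {}wU : \forall k \near \oo, 0 <= q k -> U (f (q k)) by exact: qh _ wU.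
  have qU : \forall k \near \oo, U (f (q k)).
    by near=> k; move: (q0 k); near: k; exact: wU.
  exact: qU.
have qM a : q k * a @[k --> \oo] --> h * a.
  by apply: cvgM; [exact: qh|exact: cvg_cst].
have expq : expR (q k * A u) @[k --> \oo] --> expR (h * A u).
  by apply: (cvg_comp _ _ (qM (A u))); exact: continuous_expR.
split.
- have C1 := within_q _ _ (@c_time h u (ltW h0)).
  have C2 : expR (q k * A u) * cos (q k * B u) @[k --> \oo] -->
      expR (h * A u) * cos (h * B u).
    by apply: cvgM => //; apply: (cvg_comp _ _ (qM (B u))); exact: continuous_cos.
  rewrite (_ : (fun k => expR _ * _) = (fun k => c (q k) u)) in C2; last first.
    by apply/funext => k; rewrite (gq k u).1.
  exact: (cvg_unique (@Rhausdorff R) C1 C2).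
- have C1 := within_q _ _ (@s_time h u (ltW h0)).
  have C2 : expR (q k * A u) * sin (q k * B u) @[k --> \oo] -->
      expR (h * A u) * sin (h * B u).
    by apply: cvgM => //; apply: (cvg_comp _ _ (qM (B u))); exact: continuous_sin.
  rewrite (_ : (fun k => expR _ * _) = (fun k => s (q k) u)) in C2; last first.
    by apply/funext => k; rewrite (gq k u).2.
  exact: (cvg_unique (@Rhausdorff R) C1 C2).
Unshelve. all: by end_near. Qed.

End Fixed.
End RealSemigroup.

Section LevyCharacteristic.
Context d (T : measurableType d) (R : realType) (P : probability T R).
Variable X : R -> {RV P >-> R}.
Hypothesis lX : levy_process X.
Implicit Types (g h u t e : R).

Let c h u := \int[P]_w cos (u * X h w).
Let s h u := \int[P]_w sin (u * X h w).

Let bcos := @bounded_measurable_cosM R.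

Let bsin := @bounded_measurable_sinM R.

Let increment_law h t (f : R -> R) : 0 <= h -> 0 <= t -> bounded_measurable f ->
  \int[P]_w f (X (h + t) w - X h w) = \int[P]_w f (X t w).
Proof.
move=> h0 t0 bf.
rewrite -(@eq_law_Rintegral _ _ _ _ (X (h + t) - X h : {RV P >-> R}) (X t) f)//.
by move=> B mB; rewrite -(levy_stationary lX h0 t0 mB).
Qed.

Let increments_independent g h A B : 0 <= g -> 0 <= h ->
  measurable A -> measurable B ->
  P ([set w | A (X g w - X 0 w)] `&` [set w | B (X (g + h) w - X g w)]) =
  (P [set w | A (X g w - X 0 w)%R] * P [set w | B (X (g + h) w - X g w)%R])%E.
Proof.
move=> g0 h0 mA mB.
pose t i := match i with 0%N => 0 | 1%N => g | _ => g + h end.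
pose S i := if i is 0%N then A else B.
have := levy_independent lX (k := 2) (t := t) (B := S) (lexx 0).
rewrite bigcap_mkord !big_ord_recr !big_ord0 /= setTI mul1e; apply.
- by case=> [|[|]]//= _; rewrite lerDl.
- by case.
Qed.

Let expect2 g h (a b : R -> R) : 0 <= g -> 0 <= h ->
  bounded_measurable a -> bounded_measurable b ->
  \int[P]_w (a (X g w - X 0 w) * b (X (g + h) w - X g w)) =
  (\int[P]_w a (X g w)) * (\int[P]_w b (X h w)).
Proof.
move=> g0 h0 ba bb.
rewrite -(increment_law g0 h0 bb) -(increment_law (lexx 0) g0 ba) add0r.
apply: (@independent_Rintegral _ _ _ _ (X g - X 0 : {RV P >-> R})
  (X (g + h) - X g : {RV P >-> R})) => // A B mA mB.
exact: increments_independent.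
Qed.

Let bincr g h (f : R -> R) : bounded_measurable f ->
  bounded_measurable (fun w => f (X g w - X h w)).
Proof.
move=> bf; apply: bounded_measurable_comp => //.
exact: (measurable_funB (@measurable_funPT _ _ _ _ (X g)) (@measurable_funPT _ _ _ _ (X h))).
Qed.

Let total g h u w : u * (X (g + h) w - X 0 w) =
  u * (X g w - X 0 w) + u * (X (g + h) w - X g w).
Proof. by ring. Qed.

Let cD g h u : 0 <= g -> 0 <= h -> c (g + h) u = c g u * c h u - s g u * s h u.
Proof.
move=> g0 h0; rewrite /c -(increment_law (lexx 0) (addr_ge0 g0 h0) (bcos u)) add0r.
have := expect2 g0 h0 (bcos u) (bcos u); have := expect2 g0 h0 (bsin u) (bsin u).
rewrite /s /= => <- <-; rewrite -prob_RintegralB; last 2 first.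
- by apply: bounded_measurableM; [exact: (bincr _ _ (bcos u))|exact: (bincr _ _ (bcos u))].
- by apply: bounded_measurableM; [exact: (bincr _ _ (bsin u))|exact: (bincr _ _ (bsin u))].
by apply: eq_Rintegral => w _; rewrite (total g) cosD.
Qed.

Let sD g h u : 0 <= g -> 0 <= h -> s (g + h) u = s g u * c h u + c g u * s h u.
Proof.
move=> g0 h0; rewrite /s -(increment_law (lexx 0) (addr_ge0 g0 h0) (bsin u)) add0r.
have := expect2 g0 h0 (bsin u) (bcos u); have := expect2 g0 h0 (bcos u) (bsin u).
rewrite /c /= => <- <-; rewrite -prob_RintegralD; last 2 first.
- by apply: bounded_measurableM; [exact: (bincr _ _ (bsin u))|exact: (bincr _ _ (bcos u))].
- by apply: bounded_measurableM; [exact: (bincr _ _ (bcos u))|exact: (bincr _ _ (bsin u))].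
by apply: eq_Rintegral => w _; rewrite (total g) sinD.
Qed.

Let mulX_cont x : continuous (fun u : R => u * x).
Proof. by move=> u; apply: cvgM; [exact: cvg_id|exact: cvg_cst]. Qed.

Let freq_cont (f : R -> R) h : continuous f -> (forall x, `|f x| <= 1) ->
  (forall u, bounded_measurable (fun x => f (u * x))) ->
  continuous (fun u => \int[P]_w f (u * X h w)).
Proof.
move=> cf f1 bf u.
have bfX v : bounded_measurable (fun w => f (v * X h w)).
  exact: (bounded_measurable_comp (bf v) (@measurable_funPT _ _ _ _ (X h))).
have := @continuity_under_integral R _ T P (fun u w => f (u * X h w)) setT
  measurableT (u - 1) (u + 1).
move=> /(_ (fun v _ => bounded_measurable_integrable P (bfX v)) _ (fun=> 1)) H.
apply: H.
- apply/aeW => w _ v _.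
  have cfX : {for v, continuous (f \o (fun v : R => v * X h w))}.
    exact: (continuous_comp (@mulX_cont (X h w) v) (cf (v * X h w))).
  exact cfX.
- exact: (bounded_measurable_integrable P (bounded_measurable_cst T 1)).
- by move=> v _; apply/aeW => w _.
- by rewrite inE/= in_itv/=; apply/andP; split; lra.
Qed.

(** Off an event whose probability vanishes by stochastic continuity, the argument of
    the Lipschitz function [f] moves by less than [|u| r]. *)
Let time_cont (f : R -> R) h u : 0 <= h -> (forall x, `|f x| <= 1) ->
  (forall x y, `|f x - f y| <= 2 * `|x - y|) ->
  (forall u, bounded_measurable (fun x => f (u * x))) ->
  \int[P]_w f (u * X g w) @[g --> within [set g | 0 <= g] (nbhs h)] -->
  \int[P]_w f (u * X h w).
Proof.
move=> h0 f1 f2 bf; apply/cvgrPdist_le => e e0.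
pose r := e / (4 * (`|u| + 1)).
have u1 : 0 < `|u| + 1 by rewrite ltr_wpDl.
have r0 : 0 < r by rewrite divr_gt0// mulr_gt0.
have e4 : (0 < (e / 4)%:E)%E by rewrite lte_fin divr_gt0.
have H := levy_stoch_continuous lX h0 r0.
have {H} Hnear : \forall g \near within [set g | 0 <= g] (nbhs h),
    (P [set w | (r <= `|X g w - X h w|)%R] < (e / 4)%:E)%E.
  apply: (H [set x | (x < (e / 4)%:E)%E]); apply: open_nbhs_nbhs.
  by split; [exact: open_ereal_lt_ereal|].
near=> g.
have Pg : (P [set w | (r <= `|X g w - X h w|)%R] < (e / 4)%:E)%E by near: g.
have bfX v k : bounded_measurable (fun w => f (v * X k w)).
  exact: (bounded_measurable_comp (bf v) (@measurable_funPT _ _ _ _ (X k))).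
set A := [set w | r <= `|X g w - X h w|] in Pg.
have mA : measurable A by apply: measurable_norm_ge; exact: measurable_funB.
have bA : bounded_measurable (\1_A : T -> R).
  split; first exact: measurable_indic.
  by exists 1 => w; rewrite indicE; case: (_ \in _); rewrite ?normr1 ?normr0.
have PA : \int[P]_w (\1_A w : R) <= e / 4.
  by rewrite -lee_fin EFin_prob_Rintegral// integral_indic//= setIT ltW.
rewrite -prob_RintegralB//.
have bB : bounded_measurable (fun w => f (u * X h w) - f (u * X g w)).
  exact: bounded_measurableB.
apply: le_trans (le_normr_Rintegral measurableT (bounded_measurable_integrable P bB)) _.
apply: (@le_trans _ _ (\int[P]_w (e / 2 + 2 * \1_A w))).
  apply: prob_Rintegral_le => [||w].
  - case: bB => mB [K BK]; split; first exact: measurableT_comp.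
    by exists K => w; rewrite normr_id.
  - apply: bounded_measurableD; first exact: bounded_measurable_cst.
    exact: bounded_measurableZ.
  rewrite indicE; case: (boolP (w \in A)) => [_|].
    rewrite mulr1 (le_trans (ler_normB _ _))//.
    by have := lerD (f1 (u * X h w)) (f1 (u * X g w)); lra.
  rewrite notin_setE /A/= => /negP; rewrite -ltNge => wr.
  rewrite mulr0 addr0 (le_trans (f2 _ _))// -mulrBr normrM distrC.
  have : `|u| * `|X g w - X h w| <= (`|u| + 1) * r.
    by rewrite ler_pM// ?lerDl// ltW.
  rewrite /r (_ : (`|u| + 1) * (e / (4 * (`|u| + 1))) = e / 4); first by lra.
  by field; rewrite gt_eqF.
rewrite prob_RintegralD//; last 2 first.
- exact: bounded_measurable_cst.
- exact: bounded_measurableZ.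
by rewrite prob_Rintegral_cst prob_RintegralZ//; lra.
Unshelve. all: by end_near. Qed.

Let cos_lip x y : `|cos x - cos y : R| <= 2 * `|x - y|.
Proof.
rewrite -{1}(subrK y x) cosD.
have -> : cos (x - y) * cos y - sin (x - y) * sin y - cos y =
  (cos (x - y) - 1) * cos y - sin (x - y) * sin y by ring.
rewrite (le_trans (ler_normB _ _))// !normrM mulr_natl mulr2n lerD//.
  by rewrite (le_trans _ (cos_remainder1 _))// ler_piMr// cos_max.
by rewrite (le_trans _ (sin_remainder1 _))// ler_piMr// sin_max.
Qed.

Let sin_lip x y : `|sin x - sin y : R| <= 2 * `|x - y|.
Proof.
rewrite -{1}(subrK y x) sinD.
have -> : sin (x - y) * cos y + cos (x - y) * sin y - sin y =
  sin (x - y) * cos y + (cos (x - y) - 1) * sin y by ring.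
rewrite (le_trans (ler_normD _ _))// !normrM mulr_natl mulr2n lerD//.
  by rewrite (le_trans _ (sin_remainder1 _))// ler_piMr// cos_max.
by rewrite (le_trans _ (cos_remainder1 _))// ler_piMr// sin_max.
Qed.

(** The characteristic function of [X h] is the [h]-th power of that of [X 1], for the
    branch fixed by a continuous exponent. *)
Lemma levy_process_exponent (A B : R -> R) h u :
  continuous A -> continuous B -> A 0 = 0 -> B 0 = 0 ->
  (forall u, \int[P]_w cos (u * X 1 w) = expR (A u) * cos (B u)) ->
  (forall u, \int[P]_w sin (u * X 1 w) = expR (A u) * sin (B u)) ->
  0 < h ->
  \int[P]_w cos (u * X h w) = expR (h * A u) * cos (h * B u) /\
  \int[P]_w sin (u * X h w) = expR (h * A u) * sin (h * B u).
Proof.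
move=> cA cB A0 B0 c1 s1 h0; apply: (@semigroup_exponent _ c s A B) => //.
- move=> k _; apply: freq_cont => //; first exact: continuous_cos.
  exact: cos_max.
- move=> k _; apply: freq_cont => //; first exact: continuous_sin.
  exact: sin_max.
- move=> k; rewrite /c; under eq_Rintegral do rewrite mul0r cos0.
  exact: prob_Rintegral_cst.
- move=> k; rewrite /s; under eq_Rintegral do rewrite mul0r sin0.
  exact: prob_Rintegral_cst.
- by move=> k v k0; apply: (@time_cont (@cos R)) => //; exact: cos_max.
- by move=> k v k0; apply: (@time_cont (@sin R)) => //; exact: sin_max.
Qed.

End LevyCharacteristic.

(** * Moments and exponents of a bounded Levy measure *)

Lemma measurable_norm_le (R : realType) (r : R) : measurable [set x : R | `|x| <= r].
Proof.
have mn : measurable_fun setT (fun x : R => `|x|) by exact: measurableT_comp.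
rewrite (_ : mkset _ = setT `&` (fun x : R => `|x|) @^-1` `]-oo, r]); first exact: mn.
by apply/seteqP; split => x /=; rewrite in_itv//= => -[].
Qed.

Section LevyMeasure.
Context {R : realType}.
Variables (nu : {measure set R -> \bar R}) (eps : R).
Hypothesis eps0 : 0 < eps.
Hypothesis nu_levy : levy_measure nu.
Hypothesis nu_supp : nu [set x : R | eps < `|x|] = 0%E.
Implicit Types (f g : R -> R) (t x K : R).

Local Notation D := [set x : R | `|x| <= eps].
Local Notation I k := (moment_upto nu k eps).

Let mD : measurable D := measurable_norm_le eps.

Lemma Rintegral_support f : measurable_fun setT f ->
  \int[nu]_x f x = \int[nu]_(x in D) f x.
Proof.
move=> mf; congr fine; rewrite [RHS]integral_mkcond; apply: ae_eq_integral => //.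
- exact/measurable_EFinP.
- by apply/(measurable_restrictT _ mD); apply/measurable_EFinP; exact: measurable_funTS.
exists (~` D); split; first exact: measurableC.
  rewrite (_ : ~` D = [set x : R | eps < `|x|])//.
  by apply/seteqP; split => x /=; rewrite ltNge => /negP.
move=> x /= nx Dx; apply: nx => _.
by rewrite patchE mem_set.
Qed.

(** On [D] the square is at most a multiple of [min (x^2, 1)]. *)
Lemma integrable_ball0 f K : measurable_fun setT f ->
  (forall x, D x -> `|f x| <= K * x ^+ 2) -> nu.-integrable D (EFin \o f).
Proof.
move=> mf fK; have [_ fin_min] := nu_levy.
have mmin : measurable_fun setT (fun x : R => Num.min (x ^+ 2) 1).
  by apply: measurable_minr.
have min0 x : 0 <= Num.min (x ^+ 2) 1 :> R by rewrite le_min sqr_ge0 ler01.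
have imin : nu.-integrable setT (EFin \o (fun x : R => Num.min (x ^+ 2) 1)).
  apply/integrableP; split; first exact/measurable_EFinP.
  by under eq_integral do rewrite /= ger0_norm//.
have iD : nu.-integrable D (EFin \o (fun x : R => (`|K| * (1 + eps ^+ 2)) * Num.min (x ^+ 2) 1)).
  have := integrableZl mD (`|K| * (1 + eps ^+ 2)) (integrableS measurableT mD (@subsetT _ _) imin).
  by apply: eq_integrable.
apply: le_integrable iD => //; first by apply/measurable_EFinP; exact: measurable_funTS.
move=> x Dx /=; rewrite lee_fin; apply: le_trans (fK x Dx) _.
apply: (@le_trans _ _ (`|K| * x ^+ 2)); first by rewrite ler_wpM2r ?sqr_ge0 ?ler_norm.
rewrite [leRHS]ger0_norm; last by rewrite !mulr_ge0// addr_ge0 ?sqr_ge0.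
rewrite -mulrA ler_wpM2l//.
have xe : x ^+ 2 <= eps ^+ 2.
  by rewrite -[x ^+ 2]real_normK ?num_real// lerXn2r ?nnegrE// ltW.
rewrite /Num.min; case: ifPn => [_|_].
  by rewrite ler_peMl ?sqr_ge0// lerDl sqr_ge0.
by rewrite mulr1 (le_trans xe)// lerDr.
Qed.

Lemma integrable_pow_ball0 k : nu.-integrable D (EFin \o (fun x : R => x ^+ k.+2)).
Proof.
apply: (integrable_ball0 (K := eps ^+ k)) => // x Dx.
rewrite -addn2 exprD normrM !normrX real_normK ?num_real// ler_wpM2r ?sqr_ge0//.
by rewrite lerXn2r ?nnegrE// ltW.
Qed.

Lemma moment_upto_even_ge0 j : 0 <= I (j * 2).
Proof. by apply: Rintegral_ge0 => x _; rewrite exprM sqr_ge0. Qed.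

Lemma moment_upto_bound j i : `|I (j.+1 * 2 + i)| <= eps ^+ i * I (j.+1 * 2).
Proof.
have ip := @integrable_pow_ball0 (j * 2 + i); have ij := @integrable_pow_ball0 (j * 2).
have -> : (j.+1 * 2 + i = (j * 2 + i).+2)%N by rewrite mulSn.
rewrite (le_trans (le_normr_Rintegral mD ip))//.
rewrite /moment_upto -[(j.+1 * 2)%N]/(j * 2).+2 -RintegralZl//.
apply: le_Rintegral => //.
- by have := integrable_norm ip; apply: eq_integrable.
- by have := integrableZl mD (eps ^+ i) ij; apply: eq_integrable.
move=> x Dx; have x0 : 0 <= x ^+ (j * 2).+2.
  by rewrite -[(j * 2).+2]/(j.+1 * 2)%N exprM sqr_ge0.
rewrite -[(j * 2 + i).+2]/((j * 2).+2 + i)%N addnC exprD normrM normrX (ger0_norm x0).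
by rewrite ler_wpM2r// lerXn2r ?nnegrE// ltW.
Qed.

(** The quadratic form [c |-> \int (c x - x^2)^2] is nonnegative; it is evaluated at
    its minimum. *)
Lemma moment_upto_cauchy_schwarz : I 3 ^+ 2 <= I 2 * I 4.
Proof.
have i2 := @integrable_pow_ball0 0; have i3 := @integrable_pow_ball0 1.
have i4 := @integrable_pow_ball0 2.
have iZ c k : nu.-integrable D (EFin \o (fun x : R => x ^+ k)) ->
    nu.-integrable D (EFin \o (fun x : R => c * x ^+ k)).
  by move=> ik; have := integrableZl mD c ik; apply: eq_integrable.
have quad c : 0 <= c ^+ 2 * I 2 - 2 * c * I 3 + I 4.
  rewrite /moment_upto -!RintegralZl// -RintegralB//; [|exact: iZ..].
  rewrite -RintegralD//; last by have := integrableB mD (iZ (c ^+ 2) _ i2) (iZ (2 * c) _ i3); apply: eq_integrable.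
  apply: Rintegral_ge0 => x _.
  rewrite (_ : _ + _ = (c * x - x ^+ 2) ^+ 2) ?sqr_ge0//; ring.
have I2 := moment_upto_even_ge0 1; rewrite mul1n in I2.
have I3 := moment_upto_bound 0 1; rewrite /= expr1 in I3.
have [I20|I20] := eqVneq (I 2) 0.
  move: I3; rewrite I20 mulr0 normr_le0 => /eqP ->.
  by rewrite expr0n/= mul0r.
have := quad (I 3 / I 2).
rewrite (_ : _ + _ = I 4 - I 3 ^+ 2 / I 2); last by field.
by rewrite subr_ge0 ler_pdivrMr 1?mulrC// lt_neqAle eq_sym I20.
Qed.

Let intD f g : nu.-integrable D (EFin \o f) -> nu.-integrable D (EFin \o g) ->
  nu.-integrable D (EFin \o (fun x => f x + g x)).
Proof. by move=> fi gi; have := integrableD mD fi gi; apply: eq_integrable. Qed.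

Let intB f g : nu.-integrable D (EFin \o f) -> nu.-integrable D (EFin \o g) ->
  nu.-integrable D (EFin \o (fun x => f x - g x)).
Proof. by move=> fi gi; have := integrableB mD fi gi; apply: eq_integrable. Qed.

Let intZ c f : nu.-integrable D (EFin \o f) ->
  nu.-integrable D (EFin \o (fun x => c * f x)).
Proof. by move=> fi; have := integrableZl mD c fi; apply: eq_integrable. Qed.

Let measurable_scaled f t : continuous f -> measurable_fun setT (fun x : R => f (t * x)).
Proof.
move=> cf; apply: (measurableT_comp (f := f)); last exact: measurable_funM.
exact: continuous_measurable_fun.
Qed.

Let integrable_scaled f t : continuous f -> (forall y, `|f y| <= `|y| ^+ 2) ->
  nu.-integrable D (EFin \o (fun x => f (t * x))).
Proof.
move=> cf f2; apply: (integrable_ball0 (K := t ^+ 2)); first exact: measurable_scaled.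
by move=> x _; rewrite (le_trans (f2 _))// real_normK ?num_real// exprMn.
Qed.

Let continuous_scaled f : continuous f -> (forall y, `|f y| <= `|y| ^+ 2) ->
  continuous (fun t => \int[nu]_(x in D) f (t * x)).
Proof.
move=> cf f2 t.
pose M := (`|t| + 1) ^+ 2.
have iM : nu.-integrable D (EFin \o (fun x : R => M * x ^+ 2)).
  by apply: intZ; exact: integrable_pow_ball0.
have := @continuity_under_integral R _ R nu (fun t x => f (t * x)) D mD (t - 1) (t + 1).
move=> /(_ (fun v _ => integrable_scaled v cf f2) _ (fun x => M * x ^+ 2)) H.
apply: H => //.
- apply/aeW => x _ v _.
  have cx : continuous (fun v : R => v * x).
    by move=> u; apply: cvgM; [exact: cvg_id|exact: cvg_cst].
  have cfx : {for v, continuous (f \o (fun v : R => v * x))}.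
    exact: (continuous_comp (cx v) (cf (v * x))).
  exact cfx.
- move=> v; rewrite /= in_itv/= => /andP[tv vt]; apply/aeW => x _.
  rewrite (le_trans (f2 _))// normrM exprMn (real_normK (num_real x)) ler_wpM2r ?sqr_ge0//.
  rewrite lerXn2r ?nnegrE ?addr_ge0//.
  rewrite (_ : v = t + (v - t)); last by ring.
  by rewrite (le_trans (ler_normD _ _))// lerD2l ler_norml; apply/andP; split; lra.
- by rewrite inE/= in_itv/=; apply/andP; split; lra.
Qed.

Let cos1 (y : R) : R := cos y - 1.
Let sin1 (y : R) : R := sin y - y.

Let cos1_cont : continuous cos1.
Proof. by move=> y; apply: cvgB; [exact: continuous_cos|exact: cvg_cst]. Qed.

Let sin1_cont : continuous sin1.
Proof. by move=> y; apply: cvgB; [exact: continuous_sin|exact: cvg_id]. Qed.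

(** Real and imaginary parts of the exponent of the jumps, compensated by their mean. *)
Definition jump_exponent_re t := \int[nu]_(x in D) (cos (t * x) - 1).
Definition jump_exponent_im t := \int[nu]_(x in D) (sin (t * x) - t * x).

Lemma jump_exponent_re_continuous : continuous jump_exponent_re.
Proof. exact: (continuous_scaled cos1_cont (@cos_remainder2 R)). Qed.

Lemma jump_exponent_im_continuous : continuous jump_exponent_im.
Proof. exact: (continuous_scaled sin1_cont (@sin_remainder2 R)). Qed.

Lemma jump_exponent_re0 : jump_exponent_re 0 = 0.
Proof.
rewrite /jump_exponent_re; under eq_Rintegral do rewrite mul0r cos0 subrr.
by rewrite Rintegral_cst// mul0r.
Qed.

Lemma jump_exponent_im0 : jump_exponent_im 0 = 0.
Proof.
rewrite /jump_exponent_im; under eq_Rintegral do rewrite mul0r sin0 subrr.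
by rewrite Rintegral_cst// mul0r.
Qed.

(* a pointwise Taylor expansion of the integrand integrates to one of the exponent *)
Let isO_integral f (q : R -> R -> R) (p : R -> R) n : continuous f ->
  (forall y, `|f y| <= `|y| ^+ 2) ->
  (forall t, nu.-integrable D (EFin \o q t)) ->
  (forall t, \int[nu]_(x in D) q t x = p t) ->
  (forall t x, `|f (t * x) - q t x| <= `|t * x| ^+ n.+2) ->
  isO n.+2 (fun t => \int[nu]_(x in D) f (t * x) - p t).
Proof.
move=> cf f2 iq qp fq; exists (\int[nu]_(x in D) `|x ^+ n.+2|); near=> t.
have ifq := intB (integrable_scaled t cf f2) (iq t).
rewrite -qp -RintegralB//; last exact: integrable_scaled.
rewrite (le_trans (le_normr_Rintegral mD ifq))//.
have ipow : nu.-integrable D (EFin \o (fun x : R => `|x ^+ n.+2|)).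
  by have := integrable_norm (@integrable_pow_ball0 n); apply: eq_integrable.
rewrite -RintegralZr//; apply: le_Rintegral => //.
- by have := integrable_norm ifq; apply: eq_integrable.
- have := intZ (`|t| ^+ n.+2) ipow; apply: eq_integrable => // x _ /=.
  by rewrite mulrC.
- by move=> x _; rewrite (le_trans (fq t x))// normrM exprMn mulrC normrX.
Unshelve. all: by end_near. Qed.

Lemma isO_jump_exponent_re : isO 9 (fun t => jump_exponent_re t -
  (- (I 2 / 2) * t ^+ 2 + I 4 / 24 * t ^+ 4 - I 6 / 720 * t ^+ 6
   + I 8 / (56 * 720) * t ^+ 8)).
Proof.
have ip k := @integrable_pow_ball0 k.
apply: (@isO_integral cos1 (fun t x => - (t ^+ 2 / 2) * x ^+ 2 + t ^+ 4 / 24 * x ^+ 4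
   - t ^+ 6 / 720 * x ^+ 6 + t ^+ 8 / (56 * 720) * x ^+ 8)).
- exact: cos1_cont.
- exact: cos_remainder2.
- by move=> t; apply: intD; [apply: intB; [apply: intD|]|]; apply: intZ.
- move=> t; rewrite RintegralD//; last 2 first.
  + by apply: intB; [apply: intD|]; apply: intZ.
  + exact: intZ.
  rewrite RintegralB//; last 2 first.
  + by apply: intD; apply: intZ.
  + exact: intZ.
  rewrite RintegralD//; [|exact: intZ..].
  rewrite !RintegralZl// /moment_upto.
  move: (\int[_]_(_ in _) _) (\int[_]_(_ in _) _) (\int[_]_(_ in _) _) (\int[_]_(_ in _) _) => *.
  by field.
- move=> t x; apply: le_trans (cos_remainder9 (t * x)).
  rewrite le_eqVlt; apply/orP; left; apply/eqP; congr `|_|.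
  by rewrite /cos1; field.
Qed.

Lemma isO_jump_exponent_im : isO 6 (fun t => jump_exponent_im t -
  (- (I 3 / 6) * t ^+ 3 + I 5 / 120 * t ^+ 5)).
Proof.
have ip k := @integrable_pow_ball0 k.
apply: (@isO_integral sin1 (fun t x => - (t ^+ 3 / 6) * x ^+ 3 + t ^+ 5 / 120 * x ^+ 5)).
- exact: sin1_cont.
- exact: sin_remainder2.
- by move=> t; apply: intD; apply: intZ.
- move=> t; rewrite RintegralD//; [|exact: intZ..].
  rewrite !RintegralZl// /moment_upto.
  move: (\int[_]_(_ in _) _) (\int[_]_(_ in _) _) => *.
  by field.
- move=> t x; apply: le_trans (sin_remainder6 (t * x)).
  rewrite le_eqVlt; apply/orP; left; apply/eqP; congr `|_|.
  by rewrite /sin1; field.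
Qed.

Let cos_sub1E t x : complex.Re (cexp ((t * x) *i) - 1
    - (t * x * \1_[set y : R | `|y| <= 1] x) *i)%C = cos (t * x) - 1.
Proof. by rewrite /cexp /= expR0; ring. Qed.

Let sin_subE t x : complex.Im (cexp ((t * x) *i) - 1
    - (t * x * \1_[set y : R | `|y| <= 1] x) *i)%C =
  sin (t * x) - t * x * \1_[set y : R | `|y| <= 1] x.
Proof. by rewrite /cexp /= expR0; ring. Qed.

Lemma Re_levy_exponent b Sigma t :
  complex.Re (levy_exponent b Sigma nu t) =
  - (Sigma ^+ 2 * t ^+ 2 / 2) + jump_exponent_re t.
Proof.
transitivity (- (Sigma ^+ 2 * t ^+ 2 / 2) + \int[nu]_x (cos (t * x) - 1)).
  rewrite /levy_exponent /cintegral [LHS]/= sub0r; congr (_ + _).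
  by apply: eq_Rintegral => x _; exact: cos_sub1E.
congr (_ + _); rewrite Rintegral_support//.
exact: (measurable_scaled t cos1_cont).
Qed.

Let measurable_big : measurable [set x : R | 1 < `|x| <= eps].
Proof.
have mn : measurable_fun setT (fun x : R => `|x|) by exact: measurableT_comp.
rewrite (_ : mkset _ = setT `&` (fun x : R => `|x|) @^-1` `]1, eps]); first exact: mn.
by apply/seteqP; split => x /=; rewrite in_itv//= => -[].
Qed.

(** Replacing the truncated compensator [x 1_{|x| <= 1}] by [x] turns the drift [b] into
    the mean of the law. *)
Lemma Im_levy_exponent b Sigma t :
  complex.Im (levy_exponent b Sigma nu t) = t * drift b nu eps + jump_exponent_im t.
Proof.
transitivity (t * b + \int[nu]_x
    (sin (t * x) - t * x * \1_[set y : R | `|y| <= 1] x)).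
  rewrite /levy_exponent /cintegral [LHS]/= subr0; congr (_ + _).
  by apply: eq_Rintegral => x _; exact: sin_subE.
have m1 : measurable [set y : R | `|y| <= 1] := measurable_norm_le 1.
have mtx : measurable_fun setT (fun x : R => t * x) by exact: measurable_funM.
have msin : measurable_fun setT (fun x : R => sin (t * x)).
  exact: (measurable_scaled t (@continuous_sin R)).
rewrite Rintegral_support; last first.
  by apply: measurable_funB => //; apply: measurable_funM => //; exact: measurable_indic.
pose big (x : R) : R := x * \1_[set x : R | 1 < `|x| <= eps] x.
have ibig : nu.-integrable D (EFin \o big).
  apply: (integrable_ball0 (K := 1)).
    by apply: measurable_funM => //; exact: measurable_indic.
  move=> x _; rewrite /big indicE; case: (boolP (x \in _)); last first.
    by rewrite mulr0 normr0 mul1r sqr_ge0.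
  rewrite inE/= mulr1 mul1r -(real_normK (num_real x)) => /andP[x1 _].
  by rewrite expr2 ler_peMl// ltW.
have isin := integrable_scaled t sin1_cont (@sin_remainder2 R).
have -> : \int[nu]_(x in D) (sin (t * x) - t * x * \1_[set y : R | `|y| <= 1] x) =
    jump_exponent_im t + t * \int[nu]_(x in D) big x.
  rewrite -RintegralZl// -RintegralD//; last exact: intZ.
  apply: eq_Rintegral => x; rewrite inE/= => xe.
  rewrite /big !indicE; case: (leP `|x| 1) => x1.
    rewrite mem_set//= memNset/=; last by rewrite ltNge x1.
    by ring.
  rewrite memNset/=; last by apply/negP; rewrite -ltNge.
  by rewrite mem_set/=; [ring|rewrite x1].
have bigE : \int[nu]_(x in D) big x = \int[nu]_(x in [set x : R | 1 < `|x| <= eps]) x.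
  have sub : D `&` [set x : R | 1 < `|x| <= eps] = [set x : R | 1 < `|x| <= eps].
    by apply/seteqP; split => x /=; [case|move=> /andP[? ?]; split=> //; apply/andP].
  rewrite -[in RHS]sub Rintegral_mkcondr; apply: eq_Rintegral => x _.
  rewrite /big patchE indicE; by case: ifPn => _ /=; rewrite ?mulr1 ?mulr0.
rewrite bigE /drift; case: ifPn => [e1|_]; last by ring.
rewrite (_ : [set x : R | 1 < `|x| <= eps] = set0) ?Rintegral_set0; first by ring.
apply/seteqP; split => x //= /andP[x1 xe].
by have := lt_le_trans x1 (le_trans xe e1); rewrite ltxx.
Qed.

End LevyMeasure.

(** * Cumulants of the Levy process *)

Section LevyCumulants.
Context d (T : measurableType d) (R : realType) (P : probability T R).
Variables (X : R -> {RV P >-> R}) (eps b Sigma Delta : R).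
Variable nu : {measure set R -> \bar R}.
Hypothesis eps0 : 0 < eps.
Hypothesis nu_levy : levy_measure nu.
Hypothesis nu_supp : nu [set x : R | eps < `|x|] = 0%E.
Hypothesis lX : levy_process X.
Hypothesis tX : has_triplet X b Sigma nu.
Hypothesis Delta0 : 0 < Delta.

Local Notation I k := (moment_upto nu k eps).

Let A t : R := - (Sigma ^+ 2 * t ^+ 2 / 2) + jump_exponent_re nu eps t.
Let B t : R := t * drift b nu eps + jump_exponent_im nu eps t.

Let bcos := @bounded_measurable_cosM R.

Let bsin := @bounded_measurable_sinM R.

Let char1 t : \int[P]_w cos (t * X 1 w) = expR (A t) * cos (B t) /\
  \int[P]_w sin (t * X 1 w) = expR (A t) * sin (B t).
Proof.
have tr := tX t.
rewrite -(Rintegral_distribution (X 1) (bcos t)) -(Rintegral_distribution (X 1) (bsin t)).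
rewrite /A /B -(Re_levy_exponent nu_supp b).
rewrite -(Im_levy_exponent eps0 nu_levy nu_supp b Sigma).
split.
- transitivity (complex.Re (char_fun (distribution P (X 1)) t)).
    by rewrite /char_fun /cintegral [RHS]/=; apply: eq_Rintegral => x _;
      rewrite /cexp /= expR0; ring.
  by rewrite tr /cexp; move: (levy_exponent _ _ _ _) => [x y] /=; ring.
- transitivity (complex.Im (char_fun (distribution P (X 1)) t)).
    by rewrite /char_fun /cintegral [RHS]/=; apply: eq_Rintegral => x _;
      rewrite /cexp /= expR0; ring.
  by rewrite tr /cexp; move: (levy_exponent _ _ _ _) => [x y] /=; ring.
Qed.

Let A_cont : continuous A.
Proof.
move=> t; apply: cvgD; last exact: jump_exponent_re_continuous.
apply: cvgN; apply: cvgM; last exact: cvg_cst.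
by apply: cvgM; [exact: cvg_cst|exact: exprn_continuous].
Qed.

Let B_cont : continuous B.
Proof.
move=> t; apply: cvgD; last exact: jump_exponent_im_continuous.
by apply: cvgM; [exact: cvg_id|exact: cvg_cst].
Qed.

Let charDelta t :
  \int[P]_w cos (t * X Delta w) = expR (Delta * A t) * cos (Delta * B t) /\
  \int[P]_w sin (t * X Delta w) = expR (Delta * A t) * sin (Delta * B t).
Proof.
apply: (levy_process_exponent lX t A_cont B_cont) => //.
- by rewrite /A jump_exponent_re0 expr0n/= mulr0 mul0r oppr0 addr0.
- by rewrite /B jump_exponent_im0 mul0r addr0.
- by move=> u; have [] := char1 u.
- by move=> u; have [] := char1 u.
Qed.

(** Centring at the mean removes the drift from the exponent [Delta (A + iB)]; the
    Gaussian part only contributes to the second cumulant. *)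
Lemma levy_cumulants :
  cumulants_upto8 (distribution P (X Delta)) (drift b nu eps * Delta)
    (fun j => if j == 2 then Delta * (Sigma ^+ 2 + I 2) else Delta * I j).
Proof.
set m := drift b nu eps * Delta.
exists (fun t => Delta * A t), (fun t => Delta * jump_exponent_im nu eps t).
have BE t : Delta * jump_exponent_im nu eps t = Delta * B t - t * m.
  by rewrite /B /m; ring.
have bcX t : bounded_measurable (fun w => cos (t * X Delta w)).
  exact: (bounded_measurable_comp (bcos t) (@measurable_funPT _ _ _ _ (X Delta))).
have bsX t : bounded_measurable (fun w => sin (t * X Delta w)).
  exact: (bounded_measurable_comp (bsin t) (@measurable_funPT _ _ _ _ (X Delta))).
split=> [t|t||] /=.
- rewrite (Rintegral_distribution (X Delta) (bounded_measurable_cos t m)) BE cosB mulrDr.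
  have [c1 s1] := charDelta t.
  rewrite mulrA -c1 [X in _ + X]mulrA -s1.
  transitivity (\int[P]_w (cos (t * m) * cos (t * X Delta w) + sin (t * m) * sin (t * X Delta w))).
    by apply: eq_Rintegral => w _; rewrite mulrBr cosB mulrC [X in _ + X]mulrC.
  rewrite prob_RintegralD//; [|exact: bounded_measurableZ..].
  by rewrite !prob_RintegralZ// mulrC [X in _ + X]mulrC.
- rewrite (Rintegral_distribution (X Delta) (bounded_measurable_sin t m)) BE sinB mulrBr.
  have [c1 s1] := charDelta t.
  rewrite mulrA -s1 [X in _ - X]mulrA -c1.
  transitivity (\int[P]_w (cos (t * m) * sin (t * X Delta w) - sin (t * m) * cos (t * X Delta w))).
    by apply: eq_Rintegral => w _; rewrite mulrBr sinB mulrC [X in _ - X]mulrC.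
  rewrite prob_RintegralB//; [|exact: bounded_measurableZ..].
  by rewrite !prob_RintegralZ// mulrC [X in _ - X]mulrC.
- apply: isO_ext (isOZ Delta (isO_jump_exponent_re eps0 nu_levy)) => t.
  by rewrite /A; field.
- apply: isO_ext (isOZ Delta (isO_jump_exponent_im eps0 nu_levy)) => t.
  by field.
Qed.

End LevyCumulants.

(** * The lower bound *)

Section Asymptotics.
Context {R : realType}.

Lemma logmax_ge1 n : 1 <= logmax n :> R.
Proof.
have e0 : 0 < expR 1 :> R by exact: expR_gt0.
rewrite /logmax -[X in X <= _]expRK ler_ln ?posrE ?lt_max ?e0//.
by rewrite le_max lexx.
Qed.

(** [e^L >= L^(k+1) / (k+1)!] for [L = logmax n], which tends to infinity. *)
Lemma logmax_pow_cvg k : logmax n ^+ k / n%:R @[n --> \oo] --> (0 : R).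
Proof.
apply/cvgrPdist_le => e e0.
pose K : R := k.+1`!%:R.
have K0 : 0 < K by rewrite ltr0n fact_gt0.
pose M := K / e.
near=> n.
have n1 : expR 1 <= n%:R :> R by near: n; exact: nbhs_infty_ger.
have nM : expR M <= n%:R :> R by near: n; exact: nbhs_infty_ger.
have n0 : 0 < n%:R :> R by rewrite (lt_le_trans _ n1)// expR_gt0.
have LE : logmax n = ln n%:R :> R by rewrite /logmax max_r.
have L1 := logmax_ge1 n; have L0 : 0 < logmax n :> R by exact: lt_le_trans L1.
have LM : M <= logmax n by rewrite LE -[M]expRK ler_ln ?posrE ?expR_gt0.
rewrite sub0r normrN ger0_norm; last by rewrite divr_ge0 ?exprn_ge0// ltW.
have key : logmax n ^+ k.+1 / K <= n%:R.
  have := expR_ge1Dxn k (ltW L0); rewrite LE lnK ?posrE// -/K -LE.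
  by apply: le_trans; rewrite lerDr.
rewrite ler_pdivrMr//.
have : e * (logmax n ^+ k.+1 / K) <= e * n%:R by rewrite ler_pM2l.
apply: le_trans.
rewrite exprS (_ : e * _ = logmax n ^+ k * (logmax n * e / K)); last by ring.
apply: ler_peMr; first by rewrite exprn_ge0 ?ltW.
by rewrite ler_pdivlMr// mul1r -ler_pdivrMr.
Unshelve. all: by end_near. Qed.

End Asymptotics.

Section Tests.
Context {R : realType}.
(* [P] has the cumulants [k] of a law with jumps of size at most [e], [Q] is Gaussian
   with the same variance [v], and [L] stands for [logmax n] *)
Variables (P Q : probability R R) (m v e L : R) (k : nat -> R) (n : nat).
Hypothesis Pk : cumulants_upto8 P m k.
Hypothesis Qk : cumulants_upto8 Q m (fun j => if j == 2 then v else 0).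
Hypothesis n0 : (0 < n)%N.
Hypothesis v0 : 0 < v.
Hypothesis L1 : 1 <= L.
Hypothesis eL : e ^+ 2 <= v * L ^+ 4.
Hypothesis k2 : k 2 = v.
Hypothesis k3 : `|k 3| <= e * v.
Hypothesis k3_sqr : k 3 ^+ 2 <= v * k 4.
Hypothesis k4 : k 4 <= e ^+ 2 * v.
Hypothesis k5 : `|k 5| <= e * k 4.
Hypothesis k6 : `|k 6| <= e ^+ 2 * k 4.
Hypothesis k8 : `|k 8| <= e ^+ 4 * k 4.

Let nR : (0 : R) < n%:R. Proof. by rewrite ltr0n. Qed.

Let v_ge0 : 0 <= v. Proof. exact: ltW. Qed.

Let L0 : 0 <= L. Proof. exact: le_trans ler01 L1. Qed.

Let k4_ge0 : 0 <= k 4.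
Proof. by rewrite -(pmulr_rge0 _ v0) (le_trans (sqr_ge0 _) k3_sqr). Qed.

(** Cumulants of order higher than [4] cost powers of [e] only: this bounds the eighth
    moment by its Gaussian value and a term linear in the fourth cumulant. *)
Let moment8_bound : k 8 + 28 * (k 6 * k 2) + 56 * (k 5 * k 3) + 35 * k 4 ^+ 2
  + 210 * (k 4 * k 2 ^+ 2) + 280 * (k 3 ^+ 2 * k 2) + 105 * k 2 ^+ 4
  <= 105 * v ^+ 4 + 610 * (k 4 * v ^+ 2 * L ^+ 8).
Proof.
set W := k 4 * v ^+ 2 * L ^+ 8.
have L4 : 1 <= L ^+ 4 by rewrite exprn_ege1.
have L8 : 1 <= L ^+ 8 by rewrite exprn_ege1.
have e2 : 0 <= e ^+ 2 by rewrite sqr_ge0.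
have vL : v <= v * L ^+ 4 by rewrite ler_peMr.
have WE : W = k 4 * (v * L ^+ 4) * (v * L ^+ 4) by rewrite /W; ring.
have le_W x y : 0 <= x -> 0 <= y -> x <= v * L ^+ 4 -> y <= v * L ^+ 4 ->
    k 4 * x * y <= W.
  move=> x0 y0 xv yv; rewrite WE; apply: ler_pM => //; first exact: mulr_ge0.
  exact: ler_wpM2l.
have W1 : k 4 * v * v <= W by exact: le_W.
have W2 : k 4 * e ^+ 2 * v <= W by exact: le_W.
have H8 : k 8 <= W.
  apply: le_trans (ler_norm _) (le_trans k8 _).
  rewrite (_ : e ^+ 4 * k 4 = k 4 * e ^+ 2 * e ^+ 2); last by ring.
  exact: le_W.
have H6 : k 6 * k 2 <= W.
  apply: le_trans W2; rewrite k2 ler_wpM2r//.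
  by rewrite mulrC (le_trans (ler_norm _)).
have H53 : k 5 * k 3 <= W.
  apply: le_trans W2; apply: le_trans (ler_norm _) _; rewrite normrM.
  rewrite (_ : k 4 * e ^+ 2 * v = (e * k 4) * (e * v)); last by ring.
  by rewrite ler_pM.
have H44 : k 4 ^+ 2 <= W.
  apply: le_trans W2; rewrite expr2 -mulrA ler_wpM2l//.
have H3 : k 3 ^+ 2 * k 2 <= W.
  apply: le_trans W1; rewrite k2 ler_wpM2r//.
  by rewrite mulrC.
have H2 : k 4 * k 2 ^+ 2 <= W by rewrite k2 expr2 mulrA; exact: W1.
have E : 105 * k 2 ^+ 4 = 105 * v ^+ 4 by rewrite k2.
move: H8 H6 H53 H44 H2 H3 E; clearbody W.
move: (k 6 * k 2) (k 5 * k 3) (k 4 ^+ 2) (k 4 * k 2 ^+ 2) (k 3 ^+ 2 * k 2) => a b c d f.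
move: (k 8) (105 * k 2 ^+ 4) (105 * v ^+ 4) => g h i.
by lra.
Qed.

(** The cross term [L^8 v^2 k_4] of the variance is split by
    [2 a b <= a^2 + b^2] with [a = v^2] and [b = L^8 k_4]. *)
Lemma fourth_moment_test : k 4 != 0 ->
  ((1 - 2060 * (v ^+ 4 / (n%:R * k 4 ^+ 2)) - 1220 * (L ^+ 16 / n%:R))%:E
   <= tv_dist (iid_law P n) (iid_law Q n))%E.
Proof.
move=> k40.
have l12 : k 4 + 3 * k 2 ^+ 2 != 0 + 3 * v ^+ 2 by rewrite k2 (inj_eq (addIr _)).
have := @sine_power_tv_dist_ge _ P Q m 4 _ _ _ _ n n0 (sine_power4_cvg Pk)
  (sine_power4_cvg Qk) (sine_power8_cvg Pk) (sine_power8_cvg Qk) l12.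
apply: le_trans; rewrite lee_fin /=.
have gap : k 4 + 3 * k 2 ^+ 2 - (0 + 3 * v ^+ 2) = k 4 by rewrite k2; ring.
rewrite gap; set s := k 8 + _ + _ + _ + _ + _ + _.
set s' := (X in s + X).
have s'E : s' = 105 * v ^+ 4 by rewrite /s' /=; ring.
have sv : s + s' <= 210 * v ^+ 4 + 610 * (k 4 * v ^+ 2 * L ^+ 8).
  by have := moment8_bound; rewrite -/s s'E; lra.
have nk : 0 < n%:R * k 4 ^+ 2 by rewrite mulr_gt0// exprn_even_gt0//= k40.
rewrite -addrA lerD2l -opprD lerN2 ler_pdivrMr//.
have -> : (2060 * (v ^+ 4 / (n%:R * k 4 ^+ 2)) + 1220 * (L ^+ 16 / n%:R)) *
    (n%:R * k 4 ^+ 2) = 2060 * v ^+ 4 + 1220 * (L ^+ 16 * k 4 ^+ 2).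
  by field; rewrite k40 gt_eqF.
(* [2060 = 4 * 210 + 1220] and [2 * 1220 = 4 * 610] *)
have := sqr_ge0 (v ^+ 2 - L ^+ 8 * k 4).
rewrite (_ : (v ^+ 2 - L ^+ 8 * k 4) ^+ 2 = v ^+ 4 + L ^+ 16 * k 4 ^+ 2 - 2 * (k 4 * v ^+ 2 * L ^+ 8)); last by ring.
by lra.
Qed.

(** When the fourth cumulant is too large for the sixth moment to be of Gaussian order,
    the fourth-moment test separates the laws up to a vanishing error. *)
Lemma third_moment_test : k 3 != 0 ->
  ((1 - 2060 * (v ^+ 3 / (n%:R * k 3 ^+ 2)) - 3280 * (L ^+ 16 / n%:R))%:E
   <= tv_dist (iid_law P n) (iid_law Q n))%E.
Proof.
move=> k30.
have k40 : k 4 != 0.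
  apply/negP => /eqP k40; move: k3_sqr; rewrite k40 mulr0 leNgt.
  by rewrite exprn_even_gt0//= k30.
have q0 : 0 <= v ^+ 3 / (n%:R * k 3 ^+ 2).
  apply: divr_ge0; first exact: exprn_ge0.
  by apply: mulr_ge0; [exact: ltW|exact: sqr_ge0].
have LL : L ^+ 8 <= L ^+ 16.
  by rewrite -[16%N]/(8 + 8)%N exprD ler_peMr ?exprn_ge0// exprn_ege1.
have [big|small] := ltP (v ^+ 2) (L ^+ 4 * k 4).
  apply: le_trans (fourth_moment_test k40); rewrite lee_fin.
  have nk : 0 < n%:R * k 4 ^+ 2 by rewrite mulr_gt0// exprn_even_gt0//= k40.
  have : v ^+ 4 / (n%:R * k 4 ^+ 2) <= L ^+ 16 / n%:R.
    rewrite ler_pdivrMr//.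
    have -> : L ^+ 16 / n%:R * (n%:R * k 4 ^+ 2) = L ^+ 16 * k 4 ^+ 2.
      by field; rewrite gt_eqF.
    apply: (@le_trans _ _ (L ^+ 8 * k 4 ^+ 2)); last by rewrite ler_wpM2r ?sqr_ge0.
    rewrite (_ : v ^+ 4 = v ^+ 2 * v ^+ 2); last by ring.
    rewrite (_ : L ^+ 8 * _ = (L ^+ 4 * k 4) * (L ^+ 4 * k 4)); last by ring.
    by rewrite ler_pM ?sqr_ge0// ltW.
  by move: q0; lra.
have l12 : k 3 != 0 by [].
have := @sine_power_tv_dist_ge _ P Q m 3 _ _ _ _ n n0 (sine_power3_cvg Pk)
  (sine_power3_cvg Qk) (sine_power6_cvg Pk) (sine_power6_cvg Qk) l12.
apply: le_trans; rewrite lee_fin /= subr0.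
set s := k 6 + _ + _ + _; set s' := (X in s + X).
have s'E : s' = 15 * v ^+ 3 by rewrite /s' /=; ring.
have L4 : 1 <= L ^+ 4 by rewrite exprn_ege1.
have k4v : k 4 * v <= v ^+ 3.
  rewrite (_ : v ^+ 3 = v ^+ 2 * v); last by ring.
  rewrite ler_wpM2r//; apply: le_trans small.
  by rewrite ler_peMl.
have k6v : k 6 <= v ^+ 3.
  apply: le_trans (ler_norm _) (le_trans k6 _).
  apply: (@le_trans _ _ (v * L ^+ 4 * k 4)); first by rewrite ler_wpM2r.
  rewrite -mulrA (_ : v ^+ 3 = v * v ^+ 2); last by ring.
  by rewrite ler_wpM2l// ltW.
have sv : s + s' <= 46 * v ^+ 3 + 10 * k 3 ^+ 2.
  by rewrite s'E /s k2; move: k4v k6v; lra.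
have nk : 0 < n%:R * k 3 ^+ 2 by rewrite mulr_gt0// exprn_even_gt0//= k30.
rewrite -addrA lerD2l -opprD lerN2 ler_pdivrMr//.
have -> : (2060 * (v ^+ 3 / (n%:R * k 3 ^+ 2)) + 3280 * (L ^+ 16 / n%:R)) *
    (n%:R * k 3 ^+ 2) = 2060 * v ^+ 3 + 3280 * (L ^+ 16 * k 3 ^+ 2).
  by field; rewrite k30 gt_eqF.
have : k 3 ^+ 2 <= L ^+ 16 * k 3 ^+ 2 by rewrite ler_peMl ?sqr_ge0// exprn_ege1.
have : 0 <= v ^+ 3 by rewrite exprn_ge0.
have := sqr_ge0 (k 3); lra.
Qed.

End Tests.

(** When the quotient is infinite the lower bound is [-oo]. *)
Lemma quot_infty_bound (R : realType) (C a x y : R) (tv : \bar R) : 0 < C ->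
  (y != 0 -> ((1 - C * (x / y) - a)%:E <= tv)%E) ->
  (1 - C%:E * quot_infty x y - a%:E <= tv)%E.
Proof.
move=> C0; rewrite /quot_infty; case: eqVneq => [_ _|_ /(_ isT)].
  by rewrite gt0_muley ?lte_fin//= leNye.
by rewrite -EFinM -!EFinB.
Qed.

Theorem mainTheorem2 (R : realType) :
  exists (alpha : nat -> R) (C : R),
    alpha @ \oo --> (0 : R) /\ 0 < C /\
    forall (eps b Sigma : R) (nu : {measure set R -> \bar R})
           (d : measure_display) (T : measurableType d) (P : probability T R)
           (X : R -> {RV P >-> R}),
      0 < eps -> 0 <= Sigma ->
      levy_measure nu -> nu [set x : R | eps < `|x|] = 0%E ->
      levy_process X -> has_triplet X b Sigma nu ->
    forall (n : nat) (Delta : R),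
      (1 <= n)%N -> 0 < Delta ->
      eps <= Num.sqrt ((Sigma ^+ 2 + variance_upto nu eps) * Delta)
             * logmax n ^+ 2 ->
      ((Num.max Delta^-1 (logmax n / (n%:R * Delta)))%:E
        <= intensity nu eps)%E ->
      (1 - C%:E *
           Order.min
             (quot_infty (Delta * (Sigma ^+ 2 + variance_upto nu eps) ^+ 3)
                         (n%:R * moment_upto nu 3 eps ^+ 2))
             (quot_infty (Delta ^+ 2 * (Sigma ^+ 2 + variance_upto nu eps) ^+ 4)
                         (n%:R * moment_upto nu 4 eps ^+ 2))
         - (alpha n)%:E
       <= tv_dist
            (iid_law (distribution P (X Delta)) n)
            (iid_law (gauss_law (drift b nu eps * Delta)
                                (Delta * (Sigma ^+ 2 + variance_upto nu eps))) n))%E.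
Proof.
exists (fun n => 3280 * (logmax n ^+ 16 / n%:R)), 2060; split.
  rewrite -[X in _ --> X](mulr0 3280).
  by apply: cvgM; [exact: cvg_cst|exact: logmax_pow_cvg].
have C0 : 0 < 2060 :> R by rewrite ltr0n.
split; first exact: C0.
move=> eps b Sigma nu d T P X eps0 _ nu_levy nu_supp lX tX n Delta n1 Delta0 epsL _.
set S := Sigma ^+ 2 + variance_upto nu eps.
set L := logmax n in epsL *.
have L1 : 1 <= L by exact: logmax_ge1.
have I2 : 0 <= moment_upto nu 2 eps := moment_upto_even_ge0 nu eps 1.
have I4 : 0 <= moment_upto nu 4 eps := moment_upto_even_ge0 nu eps 2.
have SD0 : 0 < S * Delta.
  rewrite ltNge; apply/negP => /ler0_sqrtr SD.
  by move: epsL; rewrite SD mul0r leNgt eps0.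
have S0 : 0 < S by rewrite -(pmulr_lgt0 _ Delta0).
have v0 : 0 < Delta * S by exact: mulr_gt0.
pose k j := if j == 2 then Delta * S else Delta * moment_upto nu j eps.
have Pk : cumulants_upto8 (distribution P (X Delta)) (drift b nu eps * Delta) k.
  exact: levy_cumulants.
have Qk := gauss_law_cumulants (drift b nu eps * Delta) v0.
have epsv : eps ^+ 2 <= Delta * S * L ^+ 4.
  rewrite (_ : Delta * S * L ^+ 4 = (Num.sqrt (S * Delta) * L ^+ 2) ^+ 2).
    apply: lerXn2r => //; rewrite nnegrE; first exact: ltW.
    by apply: mulr_ge0; [exact: sqrtr_ge0|exact: sqr_ge0].
  by rewrite exprMn sqr_sqrtr ?ltW//; ring.
have J2 : Delta * moment_upto nu 2 eps <= Delta * S.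
  by rewrite ler_pM2l// lerDr sqr_ge0.
have bound := moment_upto_bound eps0 nu_levy.
have kD j i : (2 < j.+1 * 2 + i)%N ->
    `|k (j.+1 * 2 + i)%N| <= eps ^+ i * (Delta * moment_upto nu (j.+1 * 2) eps).
  move=> ij; rewrite /k gtn_eqF// normrM (gtr0_norm Delta0) mulrCA ler_pM2l//.
have k3 : `|k 3| <= eps * (Delta * S).
  by rewrite (le_trans (kD 0%N 1%N isT))// expr1 ler_pM2l.
have k4 : k 4 <= eps ^+ 2 * (Delta * S).
  rewrite (le_trans (ler_norm _))// (le_trans (kD 0%N 2%N isT))//.
  by rewrite ler_pM2l// exprn_gt0.
have k3_sqr : k 3 ^+ 2 <= Delta * S * k 4.
  rewrite /k /= exprMn.
  rewrite (_ : _ * _ * _ = Delta ^+ 2 * (S * moment_upto nu 4 eps)); last by ring.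
  rewrite ler_pM2l ?exprn_gt0//.
  apply: le_trans (moment_upto_cauchy_schwarz eps0 nu_levy) _.
  by rewrite ler_wpM2r// lerDr sqr_ge0.
have k5 : `|k 5| <= eps * k 4 by rewrite (le_trans (kD 1%N 1%N isT)) ?expr1.
have k6 : `|k 6| <= eps ^+ 2 * k 4 := kD 1%N 2%N isT.
have k8 : `|k 8| <= eps ^+ 4 * k 4 := kD 1%N 4%N isT.
have nR : (n%:R : R) != 0 by rewrite pnatr_eq0 -lt0n.
have D0 : Delta != 0 by rewrite gt_eqF.
rewrite /Order.min; case: ifP => _; apply: (quot_infty_bound C0) => y0.
- have I30 : moment_upto nu 3 eps != 0.
    by move: y0; rewrite mulf_eq0 negb_or sqrf_eq0 => /andP[].
  have k30 : k 3 != 0 by rewrite /k /= mulf_neq0.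
  have := third_moment_test Pk Qk n1 v0 L1 epsv erefl k3 k3_sqr k4 k5 k6 k8 k30.
  apply: le_trans; rewrite lee_fin le_eqVlt; apply/orP; left; apply/eqP.
  congr (1 - _ * _ - _); rewrite /k /=.
  by field; rewrite I30 D0.
- have I40 : moment_upto nu 4 eps != 0.
    by move: y0; rewrite mulf_eq0 negb_or sqrf_eq0 => /andP[].
  have k40 : k 4 != 0 by rewrite /k /= mulf_neq0.
  have := fourth_moment_test Pk Qk n1 v0 L1 epsv erefl k3 k3_sqr k4 k5 k6 k8 k40.
  apply: le_trans; rewrite lee_fin.
  have -> : Delta ^+ 2 * S ^+ 4 / (n%:R * moment_upto nu 4 eps ^+ 2) =
      (Delta * S) ^+ 4 / (n%:R * k 4 ^+ 2).
    by rewrite /k /=; field; rewrite I40 D0.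
  have : 0 <= L ^+ 16 / n%:R by rewrite divr_ge0// exprn_ge0// (le_trans ler01).
  by lra.
Qed.
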